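(* Suppose that $(X_{n,k})_{k=1,\dots,n}$, $n\in\mathbb N$, is a triangular scheme of (row-wise) stationary real random variables with $EX_{n,k}=0$ and $EX_{n,k}^2\le C<\infty$ for all $n,k$. Assume that for all $\epsilon>0$ $$\frac1n\sum_{k=1}^nE\big[X_{n,k}^2I(|X_{n,k}|/\sqrt n>\epsilon)\big]\xrightarrow[n\to\infty]{}0$$ and that $$\operatorname{var}(X_{n,1}+\cdots+X_{n,n})/n\xrightarrow[n\to\infty]{}\sigma^2\in[0,\infty).$$ Assume further that there exist $n_0\in\mathbb N$ and a monotonically nonincreasing and summable sequence $(\theta_r)_{r\in\mathbb N}$ (not depending on $n$) such that for all $n\ge n_0$ and all indices $1\le s_1<s_2<\cdots<s_u<s_u+r=t_1\le t_2\le n$ the following hold: for all measurable $f:\mathbb R^u\to\mathbb R$ with $E f^2(X_{n,s_1},\dots,X_{n,s_u})<\infty$, $$|\operatorname{cov}(f(X_{n,s_1},\dots,X_{n,s_u}),X_{n,t_1})|\le\sqrt{Ef^2(X_{n,s_1},\dots,X_{n,s_u})}\;\theta_r,$$ and for all measurable and bounded $f:\mathbb R^u\to\mathbb R$, $$|\operatorname{cov}(f(X_{n,s_1},\dots,X_{n,s_u}),X_{n,t_1}X_{n,t_2})|\le\|f\|_\infty\,\theta_r,$$ where $\|f\|_\infty=\sup_{x\in\mathbb R^u}|f(x)|$. Then $$\frac1{\sqrt n}(X_{n,1}+\cdots+X_{n,n})\xrightarrow{d}\mathcal N(0,\sigma^2).$$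
   Context: $I(\cdot)$ denotes the indicator function. $\mathcal N(0,0)$ denotes the point mass at $0$. *)

(* Defs.v *)
From HB Require Import structures.
From mathcomp Require Import all_boot all_order all_algebra.
From mathcomp Require Import all_classical all_reals all_analysis.

Set Implicit Arguments.
Unset Strict Implicit.
Unset Printing Implicit Defensive.

Import Order.TTheory GRing.Theory Num.Theory.
Import numFieldNormedType.Exports.

Local Open Scope classical_set_scope.
Local Open Scope ring_scope.

Definition subvector (R : realType) (T : Type) (Z : nat -> T -> R) (u : nat)
    (s : 'I_u -> nat) (w : T) : u.-tuple R :=
  [tuple Z (s i) w | i < u].

(* Strict stationarity of Z_1, ..., Z_n, the values of Z outside 1..n being
   irrelevant.  The indices s need not be increasing or distinct, which is
   equivalent to the usual formulation. *)
Definition stationary_row (R : realType) (d : measure_display)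
    (T : measurableType d) (P : probability T R) (n : nat)
    (Z : nat -> {RV P >-> R}) : Prop :=
  forall (u : nat) (s : 'I_u -> nat) (h : nat),
    (forall i, (1 <= s i)%N /\ (s i + h <= n)%N) ->
    forall A : set (u.-tuple R), measurable A ->
      P (subvector Z (fun i => (s i + h)%N) @^-1` A) =
      P (subvector Z s @^-1` A).

Definition sup_norm (R : realType) (T : Type) (f : T -> R) : R :=
  sup [set `|f x| | x in [set: T]].

(* The library's normal_prob m 0 is the uniform law on [0, 1], hence the
   case distinction. *)
Definition centered_normal (R : realType) (sigma : R) :
    probability (measurableTypeR R) R :=
  if sigma == 0 then \d_(0 : measurableTypeR R) : probability _ R
  else normal_prob 0 sigma : probability _ R.

Definition cvg_in_distribution (R : realType) (d : nat -> measure_display)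
    (T : forall n, measurableType (d n)) (P : forall n, probability (T n) R)
    (Y : forall n, T n -> R)
    (mu : probability (measurableTypeR R) R) : Prop :=
  forall g : R -> R, continuous g -> bounded_fun g ->
    'E_(P n)[g \o Y n]%E @[n --> \oo] --> (\int[mu]_x (g x)%:E)%E.

(* Main.v *)
Require Import Defs.
From HB Require Import structures.
From mathcomp Require Import all_boot all_order all_algebra.
From mathcomp Require Import all_classical all_reals all_analysis.
From mathcomp Require Import measurable_realfun ring lra zify.

(** The proof is a Lindeberg argument with trigonometric test functions.  For
    fixed t and c, let Y k = t * X n k / sqrt n, let S k be the partial sums of Y
    and V k the variance of S k.  The function cos (. + c) is an eigenfunction of
    the second derivative, so a Taylor expansion of cos (S k + c) around S (k-1),
    in which sin (S (k-1) + c) * Y k is expanded again along its own past, gives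
      E cos (S k + c) = (1 - (V k - V (k-1)) / 2) * E cos (S (k-1) + c) + error.
    The covariances of Y k with its past that this expansion produces are the
    ones in the increment of the variance.  Thus E cos (S k + c) * exp (V k / 2)
    is almost constant in k, and E cos (S n + c) is close to exp (- V n / 2) cos c
    (cos_mean_step, exponential_gronwall, cos_mean_close).  The Gaussian factor
    appears here as an exponential of the variance: no Gaussian variable has to
    be put on the probability spaces of the scheme.

    Weak dependence enters in two ways.  The mean square bound, applied to the
    increments of sin (S + c), shows that lags larger than a cut-off d contribute
    O(1/n) times a tail of the series of theta, hence a small total after
    summation over the n steps.  The bound for bounded functions separates, for
    lags at most d, the cosine of a partial sum from a product of two later
    variables, after a shift of the partial sum by 2 d + 1 steps into the past.
    The Taylor and shift errors are bounded by the truncated square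
    min(1, |x|) x^2, whose total expectation over a row tends to 0 by the
    Lindeberg condition (row_trunc_sqr_le).

    It remains to pass from cosines to weak convergence.  The characteristic
    function of the normal law is found from the differential equation that it
    satisfies (mean_cos_normal_prob).  A bounded continuous function is
    approximated on an interval by a Bernstein polynomial in the coordinate
    (1 + sin (x / K)) / 2, which is a combination of cosines and is bounded on
    the whole line (sine_approx, cvg_test_bernstein); the second moments, which
    converge, control the mass far from 0 (mean_cvg_of_cos). *)

Set Implicit Arguments.
Unset Strict Implicit.
Unset Printing Implicit Defensive.

Import Order.TTheory GRing.Theory Num.Theory.
Import numFieldNormedType.Exports.

Local Open Scope classical_set_scope.
Local Open Scope ring_scope.

(** * Taylor bounds for sine and cosine *)

Section trigo_bounds.
Context {R : realType}.
Implicit Types x y : R.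

Lemma ge0_is_derive_le (f f' : R -> R) y :
  (forall x, is_derive x 1 f (f' x)) -> (forall x, 0 <= x -> 0 <= f' x) ->
  0 <= y -> f 0 <= f y.
Proof.
move=> df f'0; rewrite le_eqVlt => /predU1P[<-//|y0].
have cf : {within `[0, y], continuous f}.
  by apply: derivable_within_continuous => x _; have [] := df x.
have [c /andP[c0 _]] := MVT y0 (fun x _ => df x) cf.
rewrite subr0 => fE; rewrite -subr_ge0 fE mulr_ge0// ?f'0 ?ltW//.
Qed.

Lemma sin_le_id y : 0 <= y -> sin y <= y.
Proof.
move=> y0; have := @ge0_is_derive_le (fun x => x - sin x) (fun x => 1 - cos x) y.
rewrite sin0 subr0 subr_ge0; apply => // x _; rewrite subr_ge0; exact: cos_le1.
Qed.

Lemma normr_sin_le y : `|sin y| <= `|y|.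
Proof.
wlog y0 : y / 0 <= y.
  move=> h; have [/h//|/ltW y0] := leP 0 y.
  by rewrite -normrN -sinN -(normrN y) h// oppr_ge0.
rewrite (ger0_norm y0) ler_norml sin_le_id// andbT.
have := @ge0_is_derive_le (fun x => x + sin x) (fun x => 1 + cos x) y.
rewrite sin0 addr0 => h; have : 0 <= y + sin y.
  by apply: h => // x _; have := cos_geN1 x; lra.
lra.
Qed.

Lemma one_sub_cosE y : 1 - cos y = 2 * sin (y / 2) ^+ 2.
Proof.
have {1}-> : y = (y / 2) *+ 2 by rewrite -mulr_natr divfK.
by rewrite cos_mulr2n cos2sin2; lra.
Qed.

Lemma one_sub_cos_le_sqr y : 1 - cos y <= y ^+ 2 / 2.
Proof.
rewrite one_sub_cosE -(real_normK (num_real (sin _))) -(real_normK (num_real y)).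
have := normr_sin_le (y / 2); rewrite normrM (ger0_norm (_ : 0 <= 2^-1))//.
have := normr_ge0 (sin (y / 2)); have := normr_ge0 y; nra.
Qed.

Lemma one_sub_cos_le y : 1 - cos y <= `|y|.
Proof.
rewrite one_sub_cosE -(real_normK (num_real (sin _))).
have := normr_sin_le (y / 2); rewrite normrM (ger0_norm (_ : 0 <= 2^-1))//.
have := normr_ge0 (sin (y / 2)); have := normr_ge0 y; have := sin_max (y / 2); nra.
Qed.

(** The derivative of x^3/6 - (x - sin x) is x^2/2 - (1 - cos x), which is
    nonnegative by the previous quadratic bound. *)
Lemma id_sub_sin_le_cube y : 0 <= y -> y - sin y <= y ^+ 3 / 6.
Proof.
move=> y0.
have := @ge0_is_derive_le (fun x => x ^+ 3 / 6 - (x - sin x))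
  (fun x => x ^+ 2 / 2 - (1 - cos x)) y.
rewrite sin0 => h; rewrite -subr_ge0.
have -> : 0 = 0 ^+ 3 / 6 - (0 - 0) :> R by rewrite expr0n/= mul0r !subr0.
apply: h => // [x|x _]; last by rewrite subr_ge0 one_sub_cos_le_sqr.
apply: is_derive_eq; rewrite /GRing.scale/=; lra.
Qed.

(** The factor min(1, |y|) merges the cubic bound, good for small y, with the
    trivial one, good for large y: under the Lindeberg condition this is the
    only form in which a Taylor remainder can be summed. *)
Lemma normr_sin_sub_le y :
  `|sin y - y| <= 2 * (Num.min 1 `|y| * `|y|) /\
  `|sin y - y| <= 2 * (Num.min 1 `|y| * y ^+ 2).
Proof.
wlog y0 : y / 0 <= y.
  move=> h; have [/h//|/ltW y0] := leP 0 y.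
  move: (h (- y)); rewrite oppr_ge0 sinN sqrrN => /(_ y0); rewrite !normrN.
  by rewrite (_ : - sin y - - y = - (sin y - y)) ?normrN//; ring.
rewrite (ger0_norm y0).
have h1 := id_sub_sin_le_cube y0; have h2 := sin_le_id y0; have h3 := sin_geN1 y.
rewrite ler0_norm ?subr_le0// opprB.
have := normr_sin_le y; rewrite ler_norml (ger0_norm y0) => /andP[h4 _].
case: (leP 1 y) => y1; rewrite ?mul1r; first by split; nra.
have y2 : 0 <= y ^+ 2 by exact: sqr_ge0.
have h5 : y ^+ 3 <= y ^+ 2 by rewrite exprS ler_piMl// ltW.
have h6 : 0 <= y ^+ 3 by rewrite exprn_ge0.
rewrite -expr2 -exprS; split; lra.
Qed.

Lemma normr_cos_sub1_le y : `|cos y - 1| <= 2 * (Num.min 1 `|y|).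
Proof.
rewrite distrC ger0_norm ?subr_ge0 ?cos_le1//.
have := one_sub_cos_le y; have := cos_geN1 y; have := normr_ge0 y.
by case: (leP 1 `|y|) => y1; lra.
Qed.

(** With a = |y|/2, the left-hand side is 2 (a - sin a) (a + sin a), so the
    cubic bound on a - sin a gives a quartic bound. *)
Lemma normr_cos_sub1_le_quad y : `|cos y - 1 + y ^+ 2 / 2| <= Num.min 1 `|y| * y ^+ 2.
Proof.
have -> : cos y - 1 + y ^+ 2 / 2 = 2 * ((`|y| / 2) ^+ 2 - sin (`|y| / 2) ^+ 2).
  rewrite mulrBr -one_sub_cosE cos_norm -[in LHS](real_normK (num_real y)); lra.
rewrite -[in leRHS](real_normK (num_real y)).
have := normr_ge0 y; set a := `|y| => a0.
have a20 : 0 <= a / 2 by lra.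
have h1 := id_sub_sin_le_cube a20; have h2 := sin_le_id a20.
have := normr_sin_le (a / 2); rewrite ler_norml (ger0_norm a20) => /andP[h4 _].
rewrite ger0_norm; last by nra.
case: (leP 1 a) => a1; first by nra.
set s := sin _ in h1 h2 h4 *.
have -> : 2 * ((a / 2) ^+ 2 - s ^+ 2) = 2 * ((a / 2 - s) * (a / 2 + s)) by ring.
have : (a / 2 - s) * (a / 2 + s) <= (a / 2) ^+ 3 / 6 * (a / 2 + s).
  by rewrite ler_wpM2r//; lra.
have : (a / 2) ^+ 3 / 6 * (a / 2 + s) <= (a / 2) ^+ 3 / 6 * a.
  by rewrite ler_wpM2l//; [rewrite divr_ge0// exprn_ge0|lra].
have -> : (a / 2) ^+ 3 / 6 * a = a * (a * a ^+ 2) / 48 by field.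
have : a * (a * a ^+ 2) <= a * a ^+ 2 by rewrite ler_piMl// ?mulr_ge0 ?sqr_ge0// ltW.
have : 0 <= a * a ^+ 2 by rewrite mulr_ge0 ?sqr_ge0.
lra.
Qed.

Lemma cos_taylor2 x y :
  `|cos (x + y) - cos x + sin x * y + cos x * y ^+ 2 / 2|
  <= 3 * (Num.min 1 `|y| * y ^+ 2).
Proof.
have -> : cos (x + y) - cos x + sin x * y + cos x * y ^+ 2 / 2 =
  cos x * (cos y - 1 + y ^+ 2 / 2) - sin x * (sin y - y) by rewrite cosD; lra.
rewrite (le_trans (ler_normB _ _))// !normrM.
have h1 := normr_cos_sub1_le_quad y; have [_ h2] := normr_sin_sub_le y.
have : `|cos x| * `|cos y - 1 + y ^+ 2 / 2| <= 1 * (Num.min 1 `|y| * y ^+ 2).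
  by rewrite ler_pM// cos_max.
have : `|sin x| * `|sin y - y| <= 1 * (2 * (Num.min 1 `|y| * y ^+ 2)).
  by rewrite ler_pM// sin_max.
lra.
Qed.

Lemma sin_taylor1 x y :
  `|sin (x + y) - sin x - cos x * y| <= 4 * (Num.min 1 `|y| * `|y|).
Proof.
have -> : sin (x + y) - sin x - cos x * y =
  sin x * (cos y - 1) + cos x * (sin y - y) by rewrite sinD; lra.
rewrite (le_trans (ler_normD _ _))// !normrM.
have h1 : `|cos y - 1| <= 2 * (Num.min 1 `|y| * `|y|).
  rewrite distrC ger0_norm ?subr_ge0 ?cos_le1//.
  have := one_sub_cos_le y; have := one_sub_cos_le_sqr y.
  rewrite -[y ^+ 2](real_normK (num_real y)) expr2; have := normr_ge0 y.
  by case: (leP 1 `|y|) => y1; rewrite ?mul1r; set a := `|y| in y1 *; nra.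
have [h2 _] := normr_sin_sub_le y.
have : `|sin x| * `|cos y - 1| <= 1 * (2 * (Num.min 1 `|y| * `|y|)).
  by rewrite ler_pM// sin_max.
have : `|cos x| * `|sin y - y| <= 1 * (2 * (Num.min 1 `|y| * `|y|)).
  by rewrite ler_pM// cos_max.
lra.
Qed.

Lemma cos_dist_le x y : `|cos x - cos y| <= 4 * Num.min 1 `|x - y|.
Proof.
have -> : cos x - cos y = cos y * (cos (x - y) - 1) - sin y * sin (x - y).
  by have := cosD y (x - y); rewrite subrKC => ->; ring.
rewrite (le_trans (ler_normB _ _))// !normrM.
have : `|cos y| * `|cos (x - y) - 1| <= 1 * (2 * Num.min 1 `|x - y|).
  by rewrite ler_pM// ?cos_max// normr_cos_sub1_le.
have : `|sin y| * `|sin (x - y)| <= 1 * (Num.min 1 `|x - y|).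
  by rewrite ler_pM// ?sin_max// le_min sin_max normr_sin_le.
have : 0 <= Num.min 1 `|x - y| by rewrite le_min ler01 normr_ge0.
lra.
Qed.

Lemma sin_dist_le x y : `|sin x - sin y| <= `|x - y|.
Proof.
have sym (a b : R) : `|sin (a + b) - sin (a - b)| <= 2 * `|b|.
  have -> : sin (a + b) - sin (a - b) = 2 * (cos a * sin b).
    by rewrite sinD sinB; ring.
  rewrite normrM (ger0_norm (_ : 0 <= 2))// ler_wpM2l// normrM.
  by rewrite (le_trans (ler_piMl _ (cos_max _))) ?normr_sin_le.
have := sym ((x + y) / 2) ((x - y) / 2).
rewrite -mulrDl -mulrBl (_ : x + y + (x - y) = x * 2); last by ring.
rewrite (_ : x + y - (x - y) = y * 2); last by ring.
by rewrite !mulfK// normrM (ger0_norm (_ : 0 <= 2^-1))// mulrCA divff// mulr1.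
Qed.

End trigo_bounds.

(** * Real-valued expectations *)

Section mean.
Context {d : measure_display} {T : measurableType d} {R : realType}.
Variable P : probability T R.
Implicit Types f g h b : T -> R.

Definition rintegrable f := P.-integrable [set: T] (EFin \o f).
(** All variables below are bounded or square integrable; their expectations
    are therefore manipulated as real numbers. *)
Definition mean f : R := \int[P]_w f w.

Lemma rintegrable_measurable f : rintegrable f -> measurable_fun [set: T] f.
Proof. by move=> /integrableP[/measurable_EFinP]. Qed.

Lemma rintegrable_cst (c : R) : rintegrable (fun=> c).
Proof. exact: finite_measure_integrable_cst. Qed.

Lemma rintegrableD f g : rintegrable f -> rintegrable g ->
  rintegrable (fun w => f w + g w).
Proof. by move=> intf intg; apply: (integrableD measurableT intf intg). Qed.

Lemma rintegrableZ (c : R) f : rintegrable f -> rintegrable (fun w => c * f w).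
Proof. by move=> intf; apply: (integrableZl measurableT c intf). Qed.

Lemma rintegrableB f g : rintegrable f -> rintegrable g ->
  rintegrable (fun w => f w - g w).
Proof. by move=> intf intg; apply: (integrableB measurableT intf intg). Qed.

Lemma rintegrable_norm f : rintegrable f -> rintegrable (fun w => `|f w|).
Proof. by move=> intf; apply: (integrable_norm intf). Qed.

Lemma rintegrable_le f g : measurable_fun [set: T] f ->
  (forall w, `|f w| <= g w) -> rintegrable g -> rintegrable f.
Proof.
move=> mf fg intg; apply: (le_integrable measurableT _ _ intg) => //.
  exact/measurable_EFinP.
by move=> w _ /=; rewrite lee_fin (le_trans (fg w))// ler_norm.
Qed.

Lemma rintegrable_bounded f (M : R) : measurable_fun [set: T] f ->
  (forall w, `|f w| <= M) -> rintegrable f.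
Proof. by move=> mf fM; apply: (rintegrable_le mf fM (rintegrable_cst M)). Qed.

Lemma rintegrable_mulb b f (M : R) : measurable_fun [set: T] b ->
  (forall w, `|b w| <= M) -> rintegrable f -> rintegrable (fun w => b w * f w).
Proof.
move=> mb bM intf; apply: (@rintegrable_le _ (fun w => M * `|f w|)).
- by apply: measurable_funM => //; exact: rintegrable_measurable.
- by move=> w; rewrite normrM ler_wpM2r.
- exact/rintegrableZ/rintegrable_norm.
Qed.

Lemma rintegrable_mul f g : measurable_fun [set: T] f -> measurable_fun [set: T] g ->
  rintegrable (fun w => f w ^+ 2) -> rintegrable (fun w => g w ^+ 2) ->
  rintegrable (fun w => f w * g w).
Proof.
move=> mf mg intf intg.
apply: (@rintegrable_le _ (fun w => f w ^+ 2 + g w ^+ 2)).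
- exact: measurable_funM.
- move=> w; rewrite normrM -[f w ^+ 2](real_normK (num_real _)).
  rewrite -[g w ^+ 2](real_normK (num_real _)).
  have := normr_ge0 (f w); have := normr_ge0 (g w); nra.
- exact: rintegrableD.
Qed.

Lemma rintegrable_sqr f : measurable_fun [set: T] f ->
  rintegrable (fun w => f w ^+ 2) -> rintegrable f.
Proof.
move=> mf intf; apply: (@rintegrable_le _ (fun w => 1 + f w ^+ 2)) => //.
- move=> w; rewrite -[f w ^+ 2](real_normK (num_real _)).
  have := normr_ge0 (f w); nra.
- exact/rintegrableD/intf/rintegrable_cst.
Qed.

Lemma rintegrable_sum (I : Type) (s : seq I) (p : pred I) (F : I -> T -> R) :
  (forall i, p i -> rintegrable (F i)) ->
  rintegrable (fun w => \sum_(i <- s | p i) F i w).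
Proof.
move=> intF; apply: (eq_integrable measurableT _ _ _ (integrable_sum measurableT s intF)) => //.
by move=> w _ /=; rewrite sumEFin.
Qed.

Lemma rintegrable_sqr_sum (I : Type) (s : seq I) (F : I -> T -> R) :
  (forall i, measurable_fun [set: T] (F i)) ->
  (forall i, rintegrable (fun w => F i w ^+ 2)) ->
  rintegrable (fun w => (\sum_(i <- s) F i w) ^+ 2).
Proof.
move=> mF intF; elim: s => [|i s ih].
  by under eq_fun do rewrite big_nil expr0n; exact: rintegrable_cst.
under eq_fun do rewrite big_cons.
apply: (@rintegrable_le _ (fun w => 2 * (F i w ^+ 2 + (\sum_(i <- s) F i w) ^+ 2))).
- by apply: measurable_funX; apply: measurable_funD => //; exact: measurable_sum.
- by move=> w; rewrite ger0_norm ?sqr_ge0//; have := sqr_ge0 (F i w - \sum_(j <- s) F j w); lra.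
- exact/rintegrableZ/rintegrableD.
Qed.

Lemma mean_cst (c : R) : mean (fun=> c) = c.
Proof.
rewrite /mean Rintegral_cst// -[RHS]mulr1; congr *%R.
exact: (congr1 fine (probability_setT P)).
Qed.

Lemma meanD f g : rintegrable f -> rintegrable g ->
  mean (fun w => f w + g w) = mean f + mean g.
Proof. exact: RintegralD. Qed.

Lemma meanB f g : rintegrable f -> rintegrable g ->
  mean (fun w => f w - g w) = mean f - mean g.
Proof. exact: RintegralB. Qed.

Lemma meanZ (c : R) f : rintegrable f -> mean (fun w => c * f w) = c * mean f.
Proof. exact: RintegralZl. Qed.

Lemma eq_mean f g : f =1 g -> mean f = mean g.
Proof. by move=> /funext ->. Qed.

Lemma mean_sum (I : Type) (s : seq I) (F : I -> T -> R) :
  (forall i, rintegrable (F i)) ->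
  mean (fun w => \sum_(i <- s) F i w) = \sum_(i <- s) mean (F i).
Proof.
move=> intF; elim: s => [|i s ih].
  by rewrite big_nil -[RHS](mean_cst 0); apply: eq_mean => w; rewrite big_nil.
rewrite big_cons -ih -meanD//; last exact: rintegrable_sum.
by apply: eq_mean => w; rewrite big_cons.
Qed.

Lemma ler_mean f g : rintegrable f -> rintegrable g ->
  (forall w, f w <= g w) -> mean f <= mean g.
Proof. by move=> intf intg fg; apply: le_Rintegral. Qed.

Lemma mean_ge0 f : (forall w, 0 <= f w) -> 0 <= mean f.
Proof. by move=> f0; apply: Rintegral_ge0. Qed.

Lemma normr_mean_le f g : rintegrable f -> rintegrable g ->
  (forall w, `|f w| <= g w) -> `|mean f| <= mean g.
Proof.
move=> intf intg fg; rewrite (le_trans (le_normr_Rintegral _ _))//.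
exact/(ler_mean _ intg)/fg/rintegrable_norm.
Qed.

Lemma normr_mean_le_cst f (M : R) : rintegrable f ->
  (forall w, `|f w| <= M) -> `|mean f| <= M.
Proof.
move=> intf fM; rewrite -[leRHS]mean_cst.
exact/(normr_mean_le intf)/fM/rintegrable_cst.
Qed.

Lemma normr_meanB_le f g h : rintegrable f -> rintegrable g -> rintegrable h ->
  (forall w, `|f w - g w| <= h w) -> `|mean f - mean g| <= mean h.
Proof.
move=> intf intg inth fgh; rewrite -meanB//.
exact/normr_mean_le/fgh/inth/rintegrableB.
Qed.

Lemma mean_EFin f : rintegrable f -> 'E_P[f]%E = (mean f)%:E.
Proof.
move=> intf; rewrite unlock /mean /Rintegral fineK//.
exact: integrable_fin_num.
Qed.

End mean.

(** * The Lindeberg scheme for trigonometric functions *)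

Section real_sequences.
Context {R : realType}.

(** Subtraction of naturals truncates at 0, where F vanishes, so delaying the
    index only drops terms. *)
Lemma sum_lag_le (F : nat -> R) i n : F 0 = 0 -> (forall k, 0 <= F k) ->
  \sum_(k < n) F (k - i)%N <= \sum_(k < n) F k.
Proof.
move=> F0 Fge0; elim: i => [|i ih].
  by rewrite le_eqVlt; apply/orP; left; apply/eqP/eq_bigr => k _; rewrite subn0.
apply: le_trans ih; case: n => [|n]; first by rewrite !big_ord0.
rewrite big_ord_recl big_ord_recr/= sub0n F0 add0r.
under eq_bigr do rewrite /bump add1n subSS.
by rewrite lerDl.
Qed.

(** Both inequalities come from 1 + x <= exp x, used at x and at -x. *)
Lemma normr_expRN_sub_le (x : R) : `|x| <= 2^-1 -> `|expR (- x) - (1 - x)| <= 2 * x ^+ 2.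
Proof.
rewrite ler_norml => /andP[x1 x2].
have h1 := expR_ge1Dx (- x); have h2 := expR_ge1Dx x.
rewrite ger0_norm; last by lra.
have x0 : 0 < 1 + x by lra.
have : expR (- x) * (1 + x) <= 1.
  by rewrite -[leRHS](expRxMexpNx_1 x) mulrC ler_wpM2r ?expR_ge0.
nra.
Qed.

(** The hypothesis on e is a discrete form of the equation e' = - e V'/2: it
    says that e k * exp (V k / 2) is almost constant.  Each step changes it by
    eps k plus the second order error of 1 - x against exp (- x). *)
Lemma exponential_gronwall (e V eps : nat -> R) (omega M : R) (n : nat) :
  V 0 = 0 -> 0 <= V n -> (forall k, `|e k| <= 1) -> omega <= 2^-1 ->
  (forall k, `|V k.+1 - V k| / 2 <= omega) ->
  (forall k, (k <= n)%N -> V k / 2 <= M) ->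
  (forall k, `|e k.+1 - e k + (V k.+1 - V k) / 2 * e k| <= eps k) ->
  `|e n - expR (- (V n / 2)) * e 0| <=
    expR M * \sum_(k < n) (eps k + 2 * omega ^+ 2).
Proof.
move=> V0 Vn0 e1 om dV VM step.
have claim k : (k <= n)%N -> `|e k * expR (V k / 2) - e 0| <=
    expR M * \sum_(k < k) (eps k + 2 * omega ^+ 2).
  elim: k => [|k ih] kn; first by rewrite V0 mul0r expR0 mulr1 subrr normr0 big_ord0 mulr0.
  rewrite big_ord_recr/= mulrDr.
  set x := (V k.+1 - V k) / 2.
  have xom : `|x| <= omega by rewrite normrM (ger0_norm (_ : 0 <= 2^-1)).
  have -> : e k.+1 * expR (V k.+1 / 2) - e 0 = (e k * expR (V k / 2) - e 0) +
      expR (V k.+1 / 2) * ((e k.+1 - e k + x * e k) - e k * (expR (- x) - (1 - x))).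
    have -> : V k / 2 = V k.+1 / 2 + - x by rewrite /x; field.
    rewrite expRD; ring.
  rewrite (le_trans (ler_normD _ _))// lerD ?ih//; first by lia.
  rewrite normrM ger0_norm ?expR_ge0// ler_pM ?expR_ge0//.
    by rewrite ler_expR VM.
  rewrite (le_trans (ler_normB _ _))// lerD ?step// normrM.
  rewrite (le_trans (ler_piMl _ (e1 k)))//.
  rewrite (le_trans (normr_expRN_sub_le (le_trans xom om)))// ler_wpM2l//.
  by rewrite -[x ^+ 2](real_normK (num_real x)) lerXn2r ?nnegrE// (le_trans _ xom).
apply: le_trans (claim n (leqnn n)).
have -> : e n - expR (- (V n / 2)) * e 0 =
   expR (- (V n / 2)) * (e n * expR (V n / 2) - e 0).
  by rewrite mulrBr mulrCA [expR _ * expR _]mulrC expRxMexpNx_1 mulr1.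
rewrite normrM ger0_norm ?expR_ge0// ler_piMl// expR_le1; lra.
Qed.

(** The expectation of this truncated square is the Lindeberg functional that
    all remainder terms are reduced to.  It has no parameter epsilon, and it is
    stable under dilations and finite sums up to constants. *)
Definition trunc_sqr (x : R) := Num.min 1 `|x| * x ^+ 2.

Lemma trunc_sqr_ge0 x : 0 <= trunc_sqr x.
Proof. by rewrite mulr_ge0 ?sqr_ge0// le_min ler01 normr_ge0. Qed.

Lemma trunc_sqr_le x : trunc_sqr x <= x ^+ 2.
Proof. by rewrite ler_piMl ?sqr_ge0// ge_min lexx. Qed.

Lemma le_trunc_sqr x y : `|x| <= `|y| -> trunc_sqr x <= trunc_sqr y.
Proof.
move=> xy; rewrite /trunc_sqr -[x ^+ 2](real_normK (num_real x)).
rewrite -[y ^+ 2](real_normK (num_real y)) ler_pM ?sqr_ge0 ?le_min ?ler01 ?normr_ge0//.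
  by rewrite !ge_min lexx xy orbT.
by rewrite lerXn2r ?nnegrE.
Qed.

Lemma trunc_sqrM (a x : R) : 1 <= a -> trunc_sqr (a * x) <= a ^+ 3 * trunc_sqr x.
Proof.
move=> a1; rewrite /trunc_sqr normrM (ger0_norm (_ : 0 <= a)); last by lra.
rewrite exprMn (_ : a ^+ 3 * _ = (a * Num.min 1 `|x|) * (a ^+ 2 * x ^+ 2)); last by ring.
rewrite ler_wpM2r -?exprMn ?sqr_ge0//.
have := normr_ge0 x; case: (leP 1 `|x|) => x1 x0; rewrite ge_min.
  by rewrite mulr1 a1.
by rewrite lexx orbT.
Qed.

(** The sum is at most m times its largest term. *)
Lemma trunc_sqr_sum_le m (a : 'I_m -> R) : (forall i, 0 <= a i) ->
  trunc_sqr (\sum_i a i) <= m%:R ^+ 3 * \sum_i trunc_sqr (a i).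
Proof.
case: m a => [|m] a a0.
  by rewrite !big_ord0 mulr0 /trunc_sqr normr0 expr0n mulr0.
have [i _ ia] := @arg_maxP _ _ _ (ord0 : 'I_m.+1) xpredT a isT.
have m1 : 1 <= m.+1%:R :> R by rewrite ler1n.
have -> : \sum_j trunc_sqr (a j) = trunc_sqr (a i) + \sum_(j | j != i) trunc_sqr (a j).
  by rewrite (bigD1 i).
rewrite mulrDr; apply: le_trans (_ : m.+1%:R ^+ 3 * trunc_sqr (a i) <= _); last first.
  rewrite lerDl mulr_ge0 ?exprn_ge0// sumr_ge0// => j _; exact: trunc_sqr_ge0.
apply: le_trans (trunc_sqrM _ m1); apply: le_trunc_sqr.
rewrite !ger0_norm ?sumr_ge0 ?mulr_ge0//.
apply: le_trans (_ : \sum_(j < m.+1) a i <= _); last first.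
  by rewrite sumr_const card_ord mulr_natl.
by apply: ler_sum => j _; exact: ia.
Qed.

End real_sequences.

(** The increments Y k are the normalized variables of one row, extended by 0 at
    the index 0.  Since subtraction of naturals truncates, every lagged variable
    Y (k - j) and every lagged sum makes sense, and vanishes beyond the start of
    the row.  The hypotheses cov_YY, cov_sinY and cov_cosYY are the three
    instances of weak dependence that the argument uses. *)
Section lindeberg_step.
Context {d : measure_display} {T : measurableType d} {R : realType}.
Variables (P : probability T R) (Y : nat -> T -> R) (c delta : R) (theta : nat -> R).

Local Notation E := (mean P).

Definition psum k w := \sum_(i < k.+1) Y i w.
Local Notation S := psum.

(** Everything that happens in the last m steps before k; the remainder terms of
    step k are all bounded by its truncated square. *)
Definition window m k w := \sum_(i < m) `|Y (k - i) w|.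

Hypothesis measurable_Y : forall k, measurable_fun [set: T] (Y k).
Hypothesis Y0 : forall w, Y 0 w = 0.
Hypothesis Y_sqr_int : forall k, rintegrable P (fun w => Y k w ^+ 2).
Hypothesis delta_gt0 : 0 < delta.
Hypothesis Y_sqr_le : forall k, E (fun w => Y k w ^+ 2) <= delta.
Hypothesis Y_centered : forall k, E (Y k) = 0.
Hypothesis theta_ge0 : forall r, (0 < r)%N -> 0 <= theta r.
Hypothesis cov_YY : forall k j, (0 < j)%N ->
  `|E (fun w => Y k w * Y (k + j) w)| <= delta * theta j.
Hypothesis cov_sinY : forall k j, (0 < j)%N ->
  `|E (fun w => (sin (S k w + c) - sin (S k.-1 w + c)) * Y (k + j) w)|
  <= delta * theta j.
Hypothesis cov_cosYY : forall m r b, (0 < r)%N -> (m + r <= b)%N ->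
  `|E (fun w => cos (S m w + c) * (Y (m + r) w * Y b w)) -
    E (fun w => cos (S m w + c)) * E (fun w => Y (m + r) w * Y b w)|
  <= delta * theta r.

Lemma psum0 w : S 0 w = 0.
Proof. by rewrite /psum big_ord1 Y0. Qed.

Lemma psumS k w : S k.+1 w = S k w + Y k.+1 w.
Proof. by rewrite /psum big_ord_recr. Qed.

Lemma psum_pred k w : S k w = S k.-1 w + Y k w.
Proof. by case: k => [|k]; rewrite ?psumS//= psum0 Y0 addr0. Qed.

(** The terms are those of a telescoping sum read backwards from k.-1; since
    the indices truncate at 0, the sum may run past the start of the row. *)
Lemma telescope_lag (g : nat -> R) k n :
  \sum_(1 <= j < n.+1) (g (k - j)%N - g (k - j).-1) = g k.-1 - g (k - n.+1)%N.
Proof.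
rewrite -opprB -subn1 -(telescope_sumr (fun j => g (k - j)%N))// -sumrN.
by apply: eq_bigr => j _; rewrite opprB subnS.
Qed.

Lemma measurable_psum k : measurable_fun [set: T] (S k).
Proof. exact: measurable_sum. Qed.

Lemma psum_sqr_int k : rintegrable P (fun w => S k w ^+ 2).
Proof. exact: rintegrable_sqr_sum. Qed.

Lemma Y_int k : rintegrable P (Y k).
Proof. exact: rintegrable_sqr. Qed.

Lemma YY_int a b : rintegrable P (fun w => Y a w * Y b w).
Proof. exact: rintegrable_mul. Qed.

Lemma window_ge0 m k w : 0 <= window m k w.
Proof. exact: sumr_ge0. Qed.

Lemma measurable_window m k : measurable_fun [set: T] (window m k).
Proof. by apply: measurable_sum => i; exact: measurableT_comp. Qed.

Lemma window_int m k : rintegrable P (window m k).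
Proof. by apply: rintegrable_sum => i _; apply: rintegrable_norm; exact: Y_int. Qed.

Lemma window_sqr_int m k : rintegrable P (fun w => window m k w ^+ 2).
Proof.
apply: rintegrable_sqr_sum => i; first exact: measurableT_comp.
by under eq_fun do rewrite real_normK ?num_real//.
Qed.

Lemma measurable_trunc_sqr (f : T -> R) : measurable_fun [set: T] f ->
  measurable_fun [set: T] (fun w => trunc_sqr (f w)).
Proof.
move=> mf; apply: measurable_funM; last exact: measurable_funX.
by apply: measurable_minr => //; exact: measurableT_comp.
Qed.

Lemma trunc_sqr_int (f : T -> R) : measurable_fun [set: T] f ->
  rintegrable P (fun w => f w ^+ 2) -> rintegrable P (fun w => trunc_sqr (f w)).
Proof.
move=> mf; apply: rintegrable_le; first exact: measurable_trunc_sqr.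
by move=> w; rewrite ger0_norm ?trunc_sqr_ge0 ?trunc_sqr_le.
Qed.

Lemma Y_le_window m k i w : (i < m)%N -> `|Y (k - i) w| <= window m k w.
Proof.
by move=> im; rewrite /window (bigD1 (Ordinal im))//= lerDl sumr_ge0.
Qed.

Lemma psum_dist_le_window m k a b w : (a + b <= m)%N ->
  `|S (k - a) w - S (k - (a + b)) w| <= window m k w.
Proof.
move=> abm; have -> : S (k - a) w - S (k - (a + b)) w =
    \sum_(a <= i < a + b) Y (k - i) w.
  rewrite -opprB -(telescope_sumr (fun j => S (k - j) w)) ?leq_addr// -sumrN.
  apply: eq_bigr => i _; rewrite opprB [S (k - i) w]psum_pred subnS; ring.
rewrite (le_trans (ler_norm_sum _ _ _))// /window.
rewrite -(big_mkord xpredT (fun i => `|Y (k - i) w|)).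
rewrite [leRHS](big_cat_nat (n := a))//=; last by lia.
rewrite [X in _ <= _ + X](big_cat_nat (n := (a + b)%N))//=; last by lia.
by rewrite addrCA lerDl addr_ge0// sumr_ge0.
Qed.

Let mcos k : measurable_fun [set: T] (fun w => cos (S k w + c)).
Proof.
have mf : measurable_fun [set: R] (@cos R).
  by apply: continuous_measurable_fun; exact: continuous_cos.
apply: (measurableT_comp mf).
by apply: measurable_funD => //; exact: measurable_psum.
Qed.

Let msin k : measurable_fun [set: T] (fun w => sin (S k w + c)).
Proof.
have mf : measurable_fun [set: R] (@sin R).
  by apply: continuous_measurable_fun; exact: continuous_sin.
apply: (measurableT_comp mf).
by apply: measurable_funD => //; exact: measurable_psum.
Qed.

Let icos k : rintegrable P (fun w => cos (S k w + c)).
Proof. by apply: (rintegrable_bounded _ (M := 1)) => // w; exact: cos_max. Qed.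

Let icosM k f : rintegrable P f -> rintegrable P (fun w => cos (S k w + c) * f w).
Proof. by apply: (rintegrable_mulb (M := 1)) => // w; exact: cos_max. Qed.

Let isinM k f : rintegrable P f -> rintegrable P (fun w => sin (S k w + c) * f w).
Proof. by apply: (rintegrable_mulb (M := 1)) => // w; exact: sin_max. Qed.

Let idsinM k f : rintegrable P f ->
  rintegrable P (fun w => (sin (S k w + c) - sin (S k.-1 w + c)) * f w).
Proof.
move=> intf; apply: (rintegrable_mulb (M := 2)) => //.
  exact: measurable_funB.
move=> w; rewrite (le_trans (ler_normB _ _))// (_ : 2 = 1 + 1)//.
by rewrite lerD ?sin_max.
Qed.

Lemma mean_norm_Y_le k : E (fun w => `|Y k w|) <= Num.sqrt delta.
Proof.
have s0 : 0 < Num.sqrt delta by rewrite sqrtr_gt0.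
have ds : delta = Num.sqrt delta ^+ 2 by rewrite sqr_sqrtr// ltW.
have : E (fun w => 2 * Num.sqrt delta * `|Y k w|) <=
    E (fun w => Y k w ^+ 2 + delta).
  apply: ler_mean.
  - exact/rintegrableZ/rintegrable_norm/Y_int.
  - exact/rintegrableD/rintegrable_cst/Y_sqr_int.
  - move=> w; rewrite -[Y k w ^+ 2](real_normK (num_real _)).
    by have := sqr_ge0 (`|Y k w| - Num.sqrt delta); move: ds; lra.
rewrite meanZ; last exact/rintegrable_norm/Y_int.
rewrite meanD//; last exact: rintegrable_cst.
rewrite mean_cst => h; have hk := Y_sqr_le k.
rewrite -(ler_pM2l s0) -expr2 -ds; lra.
Qed.

Lemma mean_window_le m k : E (window m k) <= m%:R * Num.sqrt delta.
Proof.
rewrite /window mean_sum; last by move=> i; exact/rintegrable_norm/Y_int.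
apply: (@le_trans _ _ (\sum_(i < m) Num.sqrt delta)).
  by apply: ler_sum => i _; exact: mean_norm_Y_le.
by rewrite sumr_const card_ord mulr_natl.
Qed.

Lemma mean_YY_le a b : `|E (fun w => Y a w * Y b w)| <= delta.
Proof.
have : `|E (fun w => Y a w * Y b w)| <= E (fun w => 2^-1 * (Y a w ^+ 2 + Y b w ^+ 2)).
  apply: normr_mean_le; first exact: YY_int.
    exact/rintegrableZ/rintegrableD.
  move=> w; rewrite ler_norml.
  have := sqr_ge0 (Y a w + Y b w); have := sqr_ge0 (Y a w - Y b w).
  by move=> ? ?; apply/andP; split; lra.
rewrite meanZ ?meanD//; last exact: rintegrableD.
by have := Y_sqr_le a; have := Y_sqr_le b; lra.
Qed.

(** One step of the Lindeberg scheme, for a cut-off lag dd.  Taylor expansion of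
    cos (S k + c) around S k.-1 produces sin (S k.-1 + c) * Y k.  This sine is a
    telescoping sum of increments Delta.  The lags j <= dd are expanded once more
    and give cos (..) * (Y (k - j) * Y k); moving the cosine 2 * dd + 1 steps
    back before Y (k - j) makes it almost uncorrelated with that product.  The
    lags j > dd are negligible by weak dependence, because the second
    moment of Delta is at most that of Y. *)
Section one_step.
Variables (dd k : nat).
Local Notation m := (3 * dd).+1.
Local Notation U := (window m k).
Local Notation mu := (E (fun w => trunc_sqr (U w))).
Local Notation cS i := (fun w => cos (S i w + c)).
Local Notation Delta i w := (sin (S i w + c) - sin (S i.-1 w + c)).
Local Notation back j := (k - (j + (2 * dd).+1))%N.

Let iU2 : rintegrable P (fun w => trunc_sqr (U w)).
Proof. by apply: trunc_sqr_int; [exact: measurable_window|exact: window_sqr_int]. Qed.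

(* A second order remainder is a product of three factors, of which one enters
   only through min(1, .). *)
Let le_trunc_U (x y z V : R) : 0 <= x -> 0 <= y -> 0 <= z -> 0 <= V ->
  x <= V -> y <= V -> z <= V -> Num.min 1 x * (y * z) <= Num.min 1 `|V| * V ^+ 2.
Proof.
move=> x0 y0 z0 V0 xV yV zV; rewrite (ger0_norm V0) ler_pM// ?mulr_ge0//.
- by rewrite le_min ler01.
- by rewrite le_min !ge_min lexx xV orbT.
- by rewrite expr2 ler_pM.
Qed.


Let Y_le_U i w : (i <= dd)%N -> `|Y (k - i) w| <= U w.
Proof. by move=> idd; apply: Y_le_window; lia. Qed.

Let Yk_le_U w : `|Y k w| <= U w.
Proof. by rewrite -[X in Y X](subn0 k) Y_le_U. Qed.

Let back_le_U j w : (j <= dd)%N -> `|S (k - j).-1 w - S (back j) w| <= U w.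
Proof.
move=> jdd; rewrite -subnS (_ : (j + (2 * dd).+1 = j.+1 + 2 * dd)%N); last by lia.
by apply: psum_dist_le_window; lia.
Qed.

Let cos_back_le j x y w : (j <= dd)%N -> `|x| <= U w -> `|y| <= U w ->
  `|cos (S (k - j).-1 w + c) * (x * y) - cos (S (back j) w + c) * (x * y)| <=
  4 * trunc_sqr (U w).
Proof.
move=> jdd xU yU; rewrite -mulrBl !normrM.
have U0 := window_ge0 m k w.
rewrite (le_trans (ler_wpM2r _ (cos_dist_le _ _)))//.
rewrite -mulrA ler_wpM2l// le_trunc_U//.
rewrite (_ : _ - _ = S (k - j).-1 w - S (back j) w) ?back_le_U//; ring.
Qed.

Let cos_step_mean : `|E (cS k) - E (cS k.-1) + E (fun w => sin (S k.-1 w + c) * Y k w)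
   + E (fun w => cos (S k.-1 w + c) * (Y k w * Y k w)) / 2| <= 3 * mu.
Proof.
have i1 : rintegrable P (fun w => sin (S k.-1 w + c) * Y k w).
  exact/isinM/Y_int.
have i2 : rintegrable P (fun w => 2^-1 * (cos (S k.-1 w + c) * (Y k w * Y k w))).
  exact/rintegrableZ/icosM/YY_int.
rewrite [_ / 2]mulrC -[2^-1 * _]meanZ; last exact/icosM/YY_int.
rewrite -meanB// -meanD//; last exact: rintegrableB.
rewrite -meanD//; last by apply: rintegrableD => //; exact: rintegrableB.
rewrite -meanZ//.
apply: normr_mean_le.
- by do 2 apply: rintegrableD => //; exact: rintegrableB.
- exact: rintegrableZ.
- move=> w; rewrite [S k w]psum_pred [S k.-1 w + Y k w + c]addrAC.
  have := cos_taylor2 (S k.-1 w + c) (Y k w).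
  rewrite (_ : cos (S k.-1 w + c) * Y k w ^+ 2 / 2 =
    2^-1 * (cos (S k.-1 w + c) * (Y k w * Y k w))); last by rewrite expr2; ring.
  rewrite (_ : _ - _ + _ + _ = cos (S k.-1 w + c + Y k w) - cos (S k.-1 w + c) +
    2^-1 * (cos (S k.-1 w + c) * (Y k w * Y k w)) +
    sin (S k.-1 w + c) * Y k w); last by ring.
  move=> /le_trans; apply.
  rewrite ler_wpM2l// -[_ ^+ 2](real_normK (num_real (Y k w))) expr2.
  by rewrite le_trunc_U// ?window_ge0 ?Yk_le_U.
Qed.

Let near_lag j : (j <= dd)%N ->
  `|E (fun w => Delta (k - j) w * Y k w) -
    E (fun w => cos (S (back j) w + c) * (Y (k - j) w * Y k w))| <= 8 * mu.
Proof.
move=> jdd; rewrite -meanZ//; apply: normr_meanB_le.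
- exact/idsinM/Y_int.
- exact/icosM/YY_int.
- exact: rintegrableZ.
- move=> w; rewrite [S (k - j) w]psum_pred [S (k - j).-1 w + _ + c]addrAC.
  have h1 := sin_taylor1 (S (k - j).-1 w + c) (Y (k - j) w).
  have h2 := cos_back_le jdd (Y_le_U w jdd) (Yk_le_U w).
  have h3 : Num.min 1 `|Y (k - j) w| * (`|Y (k - j) w| * `|Y k w|) <= trunc_sqr (U w).
    by rewrite le_trunc_U// ?window_ge0 ?Yk_le_U ?Y_le_U.
  rewrite (_ : _ - _ = (sin (S (k - j).-1 w + c + Y (k - j) w) -
    sin (S (k - j).-1 w + c) - cos (S (k - j).-1 w + c) * Y (k - j) w) * Y k w +
    (cos (S (k - j).-1 w + c) * (Y (k - j) w * Y k w) -
     cos (S (back j) w + c) * (Y (k - j) w * Y k w))); last by ring.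
  rewrite (le_trans (ler_normD _ _))// normrM.
  have := ler_wpM2r (normr_ge0 (Y k w)) h1.
  by rewrite -!mulrA; lra.
Qed.

Let diag_lag : `|E (fun w => cos (S k.-1 w + c) * (Y k w * Y k w)) -
    E (fun w => cos (S (back 0) w + c) * (Y k w * Y k w))| <= 4 * mu.
Proof.
rewrite -meanZ//; apply: normr_meanB_le.
- exact/icosM/YY_int.
- exact/icosM/YY_int.
- exact: rintegrableZ.
- by move=> w; have := @cos_back_le 0 _ _ w isT (Yk_le_U w) (Yk_le_U w); rewrite subn0.
Qed.

(** The cosine at time back j is almost uncorrelated with the product.  Its mean
    is then replaced by the one at time k.-1, at the cost of the mean absolute
    movement of S in between, times the covariance, which is at most delta. *)
Let decouple j : (j <= dd)%N ->
  `|E (fun w => cos (S (back j) w + c) * (Y (k - j) w * Y k w)) -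
    E (cS k.-1) * E (fun w => Y (k - j) w * Y k w)| <=
  delta * theta (2 * dd).+1 + delta * (4 * E U).
Proof.
move=> jdd; set A := E _; set x := E (fun w => Y _ w * _).
have h1 : `|A - E (cS (back j)) * x| <= delta * theta (2 * dd).+1.
  have [le|lt] := leqP (j + (2 * dd).+1) k.
    have := @cov_cosYY (back j) (2 * dd).+1 k isT.
    by rewrite (_ : back j + _ = k - j)%N; [apply; lia|lia].
  (* When the row is too short, the cosine is the constant cos c. *)
  have b0 : back j = 0%N by lia.
  rewrite /A b0 (@eq_mean _ _ _ _ _ (fun w => cos c * (Y (k - j) w * Y k w))); last first.
    by move=> w; rewrite psum0 add0r.
  rewrite meanZ; last exact: YY_int.
  rewrite (@eq_mean _ _ _ _ (cS 0) (fun=> cos c)); last first.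
    by move=> w; rewrite psum0 add0r.
  by rewrite mean_cst subrr normr0 mulr_ge0 ?theta_ge0// ltW.
have h2 : `|E (cS (back j)) - E (cS k.-1)| <= 4 * E U.
  rewrite -meanZ; last exact: window_int.
  apply: normr_meanB_le => //; first exact/rintegrableZ/window_int.
  move=> w; rewrite distrC (le_trans (cos_dist_le _ _))// ler_wpM2l//.
  rewrite ge_min; apply/orP; right.
  rewrite (_ : _ - _ = S k.-1 w - S (back j) w); last by ring.
  rewrite -subn1 (_ : (j + (2 * dd).+1 = 1 + (j + 2 * dd))%N); last by lia.
  by apply: psum_dist_le_window; lia.
have -> : A - E (cS k.-1) * x = A - E (cS (back j)) * x +
   x * (E (cS (back j)) - E (cS k.-1)) by ring.
by rewrite (le_trans (ler_normD _ _))// lerD// normrM ler_pM// mean_YY_le.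
Qed.

(** The bound on Delta * Y k is linear in the standard deviation of Delta; a
    bound by the supremum of Delta would not be summable over k. *)
Let far_lag (a b : nat) : 
  `|\sum_(a.+1 <= j < b) E (fun w => Delta (k - j) w * Y k w)| <=
    delta * \sum_(a.+1 <= j < b) theta j /\
  `|\sum_(a.+1 <= j < b) E (fun w => Y (k - j) w * Y k w)| <=
    delta * \sum_(a.+1 <= j < b) theta j.
Proof.
rewrite mulr_sumr.
split; rewrite (le_trans (ler_norm_sum _ _ _))// big_nat [leRHS]big_nat;
  apply: ler_sum => j /andP[aj _].
- have [kj|jk] := leqP k j.
    rewrite (_ : k - j = 0)%N; last by lia.
    rewrite (@eq_mean _ _ _ _ _ (fun=> 0)); last by move=> w; rewrite subrr mul0r.
    by rewrite mean_cst normr0 mulr_ge0 ?theta_ge0 ?(ltW delta_gt0)//; lia.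
  have := @cov_sinY (k - j)%N j; rewrite subnK; [apply|]; lia.
- have [kj|jk] := leqP k j.
    rewrite (_ : k - j = 0)%N; last by lia.
    rewrite (@eq_mean _ _ _ _ _ (fun=> 0)); last by move=> w; rewrite Y0 mul0r.
    by rewrite mean_cst normr0 mulr_ge0 ?theta_ge0 ?(ltW delta_gt0)//; lia.
  have := @cov_YY (k - j)%N j; rewrite subnK; [apply|]; lia.
Qed.

Let sinY_decomp : E (fun w => sin (S k.-1 w + c) * Y k w) =
  \sum_(1 <= j < (dd + k).+1) E (fun w => Delta (k - j) w * Y k w).
Proof.
rewrite -mean_sum; last by move=> j; exact/idsinM/Y_int.
rewrite -[LHS]subr0 -[X in _ - X](mulr0 (sin c)) -[X in _ * X](Y_centered k).
rewrite -meanZ; last exact: Y_int.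
rewrite -meanB; first last.
- exact/rintegrableZ/Y_int.
- exact/isinM/Y_int.
apply: eq_mean => w /=; rewrite -mulr_suml.
rewrite (telescope_lag (fun i => sin (S i w + c))).
by rewrite (_ : k - _ = 0)%N ?psum0 ?add0r ?mulrBl//; lia.
Qed.

(** The increment of the variance of S collects exactly the covariances that the
    expansion of the cosine produces. *)
Let var_incr : E (fun w => S k w ^+ 2) - E (fun w => S k.-1 w ^+ 2) =
  E (fun w => Y k w * Y k w) +
  2 * \sum_(1 <= j < (dd + k).+1) E (fun w => Y (k - j) w * Y k w).
Proof.
rewrite -mean_sum; last by move=> j; exact: YY_int.
rewrite -meanZ; last by apply: rintegrable_sum => j _; exact: YY_int.
rewrite -meanB; [|exact: psum_sqr_int..].
rewrite -meanD; [|exact: YY_int|]; last first.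
  by apply/rintegrableZ/rintegrable_sum => j _; exact: YY_int.
apply: eq_mean => w /=; rewrite -mulr_suml.
have : \sum_(1 <= j < (dd + k).+1) Y (k - j) w = S k.-1 w.
  rewrite -[RHS]subr0 -[X in _ - X](psum0 w).
  rewrite -[0%N in X in _ - X](_ : k - (dd + k).+1 = 0)%N; last by lia.
  rewrite -(telescope_lag (fun i => S i w)); apply: eq_bigr => j _.
  by rewrite [S (k - j) w]psum_pred; ring.
by move=> ->; rewrite [S k w]psum_pred; ring.
Qed.


Hypothesis theta_noninc : forall r r', (0 < r)%N -> (r <= r')%N -> theta r' <= theta r.
Variable tau : R.
Hypothesis tail_le : forall N, \sum_(dd.+1 <= j < N) theta j <= tau.

(** The decoupling error theta (2 * dd + 1) occurs dd + 1 times; by monotonicity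
    it is at most each of the dd + 1 terms theta (dd + 1), .., theta (2 * dd + 1)
    of the tail sum. *)
Lemma theta_gap_le : dd.+1%:R * theta (2 * dd).+1 <= tau.
Proof.
apply: le_trans (tail_le (2 * dd).+2).
rewrite -[X in X%:R](_ : (2 * dd).+2 - dd.+1 = dd.+1)%N; last by lia.
rewrite mulr_natl -sumr_const_nat big_nat [leRHS]big_nat.
by apply: ler_sum => j /andP[dj jd]; apply: theta_noninc; lia.
Qed.

(** The mean of cos (S k + c) is multiplied at step k by approximately 1 minus
    half of the increment of the variance. *)
Lemma cos_mean_step :
  `|E (cS k) - E (cS k.-1) +
    (E (fun w => S k w ^+ 2) - E (fun w => S k.-1 w ^+ 2)) / 2 * E (cS k.-1)| <=
  (8 * dd + 5)%:R * mu + 4 * dd.+1%:R * (delta * E U) + 3 * (delta * tau).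
Proof.
rewrite var_incr.
have split_near (F : nat -> R) : \sum_(1 <= j < (dd + k).+1) F j =
    \sum_(1 <= j < dd.+1) F j + \sum_(dd.+1 <= j < (dd + k).+1) F j.
  by rewrite (big_cat_nat (n := dd.+1))//=; lia.
have hs := sinY_decomp; rewrite split_near in hs; rewrite split_near.
have [] := far_lag dd (dd + k).+1.
set Bf := \sum_(dd.+1 <= j < _) E _ in hs *; set xf := \sum_(dd.+1 <= j < _) E _.
set Bn := \sum_(1 <= j < dd.+1) E _ in hs *; set xn := \sum_(1 <= j < dd.+1) E _.
move=> hBf hxf; have hstep := cos_step_mean; rewrite hs in hstep.
have hdiag := diag_lag; have := decouple (leq0n dd); rewrite subn0 => hdec0.
set e := E (cS k.-1) in hstep hdec0 *; set x0 := E (fun w => Y k w * Y k w) in hdec0 *.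
set q := E (fun w => cos (S k.-1 w + c) * _) in hstep hdiag.
set A0 := E (fun w => cos (S (back 0) w + c) * _) in hdiag hdec0.
have hn : `|Bn - e * xn| <= dd%:R * (8 * mu + (delta * theta (2 * dd).+1 + delta * (4 * E U))).
  rewrite /Bn /xn mulr_sumr -sumrB (le_trans (ler_norm_sum _ _ _))//.
  rewrite -[X in X%:R](subn1 dd.+1) mulr_natl -sumr_const_nat big_nat [leRHS]big_nat.
  apply: ler_sum => j /andP[_ jd].
  have jd' : (j <= dd)%N := jd.
  exact: le_trans (ler_distD _ _ _) (lerD (near_lag jd') (decouple jd')).
have tau_ge : delta * \sum_(dd.+1 <= j < (dd + k).+1) theta j <= delta * tau.
  by rewrite ler_pM2l.
have he : `|e| <= 1 by apply: normr_mean_le_cst => // w; exact: cos_max.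
have hexf : `|e * xf| <= delta * tau.
  by rewrite normrM (le_trans (ler_piMl _ he))// (le_trans hxf).
have hgap : delta * (dd.+1%:R * theta (2 * dd).+1) <= delta * tau.
  by rewrite ler_pM2l// theta_gap_le.
have mu0 : 0 <= mu by apply: mean_ge0 => w; exact: trunc_sqr_ge0.
have eu0 : 0 <= delta * E U.
  by rewrite mulr_ge0 ?(ltW delta_gt0)// mean_ge0// => w; exact: window_ge0.
have gt0 : 0 <= delta * theta (2 * dd).+1 by rewrite mulr_ge0 ?theta_ge0 ?(ltW delta_gt0).
have {hBf} hBf := le_trans hBf tau_ge.
set E1 := E (cS k) in hstep *.
(* The errors: Taylor remainder, near lags, far lags, diagonal term, and
   the far covariances that the variance increment contains. *)
have -> : E1 - e + (x0 + 2 * (xn + xf)) / 2 * e =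
  (E1 - e + (Bn + Bf) + q / 2) - (Bn - e * xn) - Bf - (q - A0) / 2 - (A0 - e * x0) / 2
  + e * xf by field.
move: hstep hn hBf hdiag hdec0 hexf hgap mu0 eu0 gt0.
rewrite natrD natrM -[dd.+1]addn1 natrD.
rewrite !ler_norml.
set EU := E U; set th := theta _; set DT := delta * tau.
set DE := delta * EU; set DH := delta * th.
rewrite (_ : delta * (4 * EU) = 4 * DE); last by rewrite /DE; ring.
rewrite (_ : delta * ((dd%:R + 1) * th) = (dd%:R + 1) * DH); last by rewrite /DH; ring.
move=> /andP[? ?] /andP[? ?] /andP[? ?] /andP[? ?] /andP[? ?] /andP[? ?] ? ? ? ?.
by apply/andP; split; lra.
Qed.


Lemma var_incr_le B : (forall N, \sum_(1 <= j < N) theta j <= B) ->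
  `|E (fun w => S k w ^+ 2) - E (fun w => S k.-1 w ^+ 2)| <= delta * (1 + 2 * B).
Proof.
move=> hB; rewrite var_incr (le_trans (ler_normD _ _))// mulrDr mulr1 lerD ?mean_YY_le//.
rewrite normrM ger0_norm// mulrCA ler_wpM2l//.
have [_ /le_trans] := far_lag 0 (dd + k).+1; apply.
by rewrite ler_pM2l.
Qed.

End one_step.

Let V k := E (fun w => S k w ^+ 2).

(** A window has m terms and each index lies in at most m windows, whence the
    fourth power: three factors m come from trunc_sqr_sum_le. *)
Lemma sum_mean_trunc_window m n :
  \sum_(k < n) E (fun w => trunc_sqr (window m k.+1 w)) <=
  m%:R ^+ 4 * \sum_(k < n.+1) E (fun w => trunc_sqr (Y k w)).
Proof.
have tY j : rintegrable P (fun w => trunc_sqr (Y j w)) by exact: trunc_sqr_int.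
apply: le_trans (_ : \sum_(k < n.+1) E (fun w => trunc_sqr (window m k w)) <= _).
  by rewrite big_ord_recl/= lerDr mean_ge0// => w; exact: trunc_sqr_ge0.
apply: le_trans (_ : \sum_(k < n.+1) m%:R ^+ 3 *
    \sum_(i < m) E (fun w => trunc_sqr (Y (k - i) w)) <= _).
  apply: ler_sum => k _; rewrite -mean_sum// -meanZ; last exact: rintegrable_sum.
  apply: ler_mean.
  - by apply: trunc_sqr_int; [exact: measurable_window|exact: window_sqr_int].
  - by apply: rintegrableZ; exact: rintegrable_sum.
  - move=> w; rewrite /window (le_trans (trunc_sqr_sum_le _))//.
    rewrite ler_wpM2l ?exprn_ge0//; apply: ler_sum => i _.
    by rewrite le_trunc_sqr// normr_id.
rewrite -mulr_sumr exchange_big/= [m%:R ^+ 4]exprSr -mulrA ler_wpM2l ?exprn_ge0//.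
apply: le_trans (_ : \sum_(i < m) \sum_(k < n.+1) E (fun w => trunc_sqr (Y k w)) <= _).
  apply: ler_sum => i _.
  apply: (@sum_lag_le _ (fun k => E (fun w => trunc_sqr (Y k w)))).
    rewrite -[RHS](mean_cst P); apply: eq_mean => w.
    by rewrite Y0 /trunc_sqr expr0n mulr0.
  by move=> j; apply: mean_ge0 => w; exact: trunc_sqr_ge0.
by rewrite sumr_const card_ord mulr_natl.
Qed.

(** Iterating the steps, with delta of order 1/n: only the term 3 * tau survives
    when n grows, and it is small when the cut-off dd is large. *)
Lemma cos_mean_close (B tau : R) (dd n : nat) :
  (forall r r', (0 < r)%N -> (r <= r')%N -> theta r' <= theta r) ->
  (forall N, \sum_(1 <= j < N) theta j <= B) ->
  (forall N, \sum_(dd.+1 <= j < N) theta j <= tau) ->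
  delta * (1 + 2 * B) <= 1 ->
  `|E (fun w => cos (S n w + c)) - expR (- (V n / 2)) * cos c| <=
  expR (n%:R * delta * (1 + 2 * B)) *
  ((8 * dd + 5)%:R * (3 * dd).+1%:R ^+ 4 * \sum_(k < n.+1) E (fun w => trunc_sqr (Y k w)) +
   n%:R * delta * (4 * dd.+1%:R * ((3 * dd).+1%:R * Num.sqrt delta) + 3 * tau
                   + delta * (1 + 2 * B) ^+ 2)).
Proof.
move=> theta_noninc hB htau dB1.
have B0 : 0 <= B by have := hB 0%N; rewrite big_geq.
have dB0 : 0 <= delta * (1 + 2 * B) by rewrite mulr_ge0 ?ltW//; lra.
have V0 : V 0 = 0.
  by rewrite -[RHS](mean_cst P); apply: eq_mean => w; rewrite psum0 expr0n.
have Vincr k : `|V k.+1 - V k| <= delta * (1 + 2 * B) by exact: (@var_incr_le 0 k.+1).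
have Vle k : V k <= k%:R * (delta * (1 + 2 * B)).
  elim: k => [|k ih]; first by rewrite V0 mul0r.
  rewrite -natr1 mulrDl mul1r; have := Vincr k; rewrite ler_norml => /andP[_].
  by move: ih; lra.
have E0 : E (fun w => cos (S 0 w + c)) = cos c.
  by rewrite -[RHS](mean_cst P); apply: eq_mean => w; rewrite psum0 add0r.
rewrite -{1}E0.
apply: le_trans (@exponential_gronwall R (fun k => E (fun w => cos (S k w + c))) V
  (fun k => (8 * dd + 5)%:R * E (fun w => trunc_sqr (window (3 * dd).+1 k.+1 w)) +
   4 * dd.+1%:R * (delta * E (window (3 * dd).+1 k.+1)) + 3 * (delta * tau))
  (delta * (1 + 2 * B) / 2) (n%:R * delta * (1 + 2 * B)) n _ _ _ _ _ _ _) _ => //.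
- by apply: mean_ge0 => w; exact: sqr_ge0.
- move=> k; apply: normr_mean_le_cst => [|w]; last exact: cos_max.
  by apply: (rintegrable_bounded _ (M := 1)) => // w; exact: cos_max.
- by lra.
- by move=> k; rewrite ler_wpM2r.
- move=> k kn; apply: le_trans (_ : V k <= _).
    by rewrite ler_pdivrMr// ler_peMr ?ler1n// mean_ge0// => w; exact: sqr_ge0.
  by rewrite (le_trans (Vle k))// -mulrA ler_wpM2r// ler_nat.
- by move=> k; exact: (@cos_mean_step dd k.+1).
rewrite ler_wpM2l ?expR_ge0// big_split/= big_split/= big_split/= -!mulr_sumr.
rewrite !sumr_const !card_ord -[tau *+ n]mulr_natr -[2^-1 *+ n]mulr_natr.
have h1 := sum_mean_trunc_window (3 * dd).+1 n.
have h2 : \sum_(k < n) E (window (3 * dd).+1 k.+1) <=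
    n%:R * ((3 * dd).+1%:R * Num.sqrt delta).
  rewrite mulr_natl -[X in _ *+ X](card_ord n) -sumr_const.
  by apply: ler_sum => k _; exact: mean_window_le.
have h3 := ler_wpM2l (ler0n R (8 * dd + 5)) h1.
have d4 : 0 <= 4 * dd.+1%:R * delta by rewrite !mulr_ge0// ltW.
have h4 := ler_wpM2l d4 h2.
have h5 : 0 <= n%:R * delta * (delta * (1 + 2 * B) ^+ 2).
  by apply: mulr_ge0; apply: mulr_ge0; rewrite ?sqr_ge0 ?(ltW delta_gt0).
move: h3 h4 h5.
set s1 := \sum_(k < n) E (fun w => _); set s2 := \sum_(k < n.+1) _.
set s3 := \sum_(k < n) E (window _ _); set sq := Num.sqrt delta.
move: (8 * dd + 5)%:R ((3 * dd).+1%:R) (dd.+1%:R) => a1 a2 a3.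
by lra.
Qed.

End lindeberg_step.

(** * The characteristic function of a centered normal law *)

Section gaussian.
Context {R : realType}.
Local Notation leb := (@lebesgue_measure R).

(** The integral over [-n, n] is F n - F (-n); it converges to the integral over
    the line by dominated convergence. *)
Lemma integral_derivative_eq0 (F f : R -> R) :
  (forall x : R, is_derive x 1 F (f x)) -> continuous f ->
  leb.-integrable [set: R] (EFin \o f) ->
  (F n%:R - F (- n%:R)) @[n --> \oo] --> (0 : R) ->
  \int[leb]_x f x = 0.
Proof.
move=> dF cf intf F0.
have mf : measurable_fun [set: R] f by exact: continuous_measurable_fun.
pose fn n : R -> R := f \_ `[- n%:R, n%:R].
have lim1 : (\int[leb]_x (fn n x)%:E)%E @[n --> \oo] --> (\int[leb]_x (f x)%:E)%E.
  apply: (@dominated_cvg _ _ _ leb setT measurableT (fun n x => (fn n x)%:E)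
      (EFin \o f) (fun x => `|f x|%:E)).
  - move=> n; apply/measurable_EFinP/(measurable_restrictT _ _).1 => //.
    exact: measurable_funTS.
  - move=> x _; apply: cvg_EFin; first exact: nearW.
    apply: cvg_near_cst; near=> n.
    rewrite /= /fn patchE ifT//; apply/mem_set => /=.
    have : `|x| <= n%:R by near: n; exact: nbhs_infty_ger.
    by rewrite in_itv/= ler_norml.
  - by [].
  - exact: (integrable_norm intf).
  - move=> n x _; rewrite lee_fin /fn patchE.
    by case: ifP => // _; rewrite normr0.
have lim2 : (\int[leb]_x (fn n x)%:E)%E @[n --> \oo] --> 0%E.
  have : (F n%:R - F (- n%:R))%:E @[n --> \oo] --> 0%E.
    by apply: cvg_EFin; [exact: nearW|exact: F0].
  apply: cvg_trans; apply: near_eq_cvg; near=> n.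
  have n0 : (0 < n)%N by near: n; exists 1%N.
  have dF' x : derivable F x 1 by have [] := dF x.
  have Fc : continuous F.
    by move=> x; apply: differentiable_continuous; apply/derivable1_diffP.
  have : (\int[leb]_(x in `[(- n%:R)%R, n%:R%R]) (f x)%:E =
      (F n%:R%R)%:E - (F (- n%:R)%R)%:E)%E.
    apply: continuous_FTC2.
    - by rewrite -subr_gt0 opprK -natrD ltr0n addn_gt0 n0.
    - exact: continuous_subspaceT.
    - split.
      + by move=> x _.
      + exact/cvg_at_right_filter/Fc.
      + exact/cvg_at_left_filter/Fc.
    - by move=> x _; rewrite derive1E; have [_] := dF x.
  rewrite [in X in X -> _]integral_mkcond/= restrict_EFin => ->.
  by rewrite EFinB.
have := cvg_unique _ lim1 lim2 => /(_ (@ereal_hausdorff R)).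
by rewrite /Rintegral => ->.
Unshelve. all: by end_near.
Qed.

(** The density is a Radon-Nikodym derivative of the normal law, and two such
    derivatives agree almost everywhere. *)
Lemma integral_normal_prob (s : R) (f : R -> R) : s != 0 ->
  measurable_fun [set: R] f -> (exists M, forall x, `|f x| <= M) ->
  mean (normal_prob 0 s) f = \int[leb]_x (f x * normal_pdf 0 s x).
Proof.
move=> s0 mf [M fM]; rewrite /mean /Rintegral; congr fine.
have intf : (normal_prob 0 s).-integrable [set: R] (EFin \o f).
  exact: (@rintegrable_bounded _ _ _ (normal_prob 0 s) f M mf fM).
rewrite -(Radon_Nikodym_change_of_variables (normal_prob_dominates 0 s))//=.
apply: ae_eq_integral => //.
- apply: emeasurable_funM; first exact/measurable_EFinP.
  apply: (measurable_int leb).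
  by apply: Radon_Nikodym_integrable; exact: normal_prob_dominates.
- apply/measurable_EFinP/measurable_funM => //; exact: measurable_normal_pdf.
- under [X in ae_eq _ _ _ X]eq_fun do rewrite EFinM.
  apply: ae_eqe_mul2l => /=.
  rewrite Radon_NikodymE//=; first exact: normal_prob_dominates.
  move=> abmu; case: cid => /= h [h1 h2 h3].
  apply: integral_ae_eq => //=.
  + by apply/measurable_EFinP; exact: measurable_normal_pdf.
  + by move=> E E01 mE; rewrite -h3.
Qed.


Section characteristic_function.
Variable s : R.
Hypothesis s0 : s != 0.
Local Notation p := (normal_pdf 0 s).

Let pE x : p x = normal_peak s * expR (- x ^+ 2 / (s ^+ 2 *+ 2)).
Proof. by rewrite normal_pdfE// /normal_fun subr0. Qed.

Let s2_gt0 : 0 < s ^+ 2.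
Proof. by rewrite exprn_even_gt0. Qed.

Let int_p : leb.-integrable [set: R] (EFin \o p).
Proof. exact: integrable_normal_pdf. Qed.

(** The factor |x| is absorbed by doubling the standard deviation. *)
Let int_norm_p : leb.-integrable [set: R] (EFin \o (fun x => `|x| * p x)).
Proof.
pose A := 1 + 8 * s ^+ 2 / 3.
have s20 : 2 * s != 0 by rewrite mulf_neq0.
pose K := A * normal_peak s / normal_peak (2 * s).
have intK : leb.-integrable [set: R] (EFin \o (fun x => K * normal_pdf 0 (2 * s) x)).
  exact: (integrableZl measurableT K (integrable_normal_pdf 0 (2 * s))).
apply: (le_integrable measurableT _ _ intK).
  apply/measurable_EFinP/measurable_funM.
    by apply: continuous_measurable_fun; exact: norm_continuous.
  exact: measurable_normal_pdf.
move=> x _; rewrite /= lee_fin normrM normr_id [`|p x|]ger0_norm ?normal_pdf_ge0//.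
apply: le_trans (ler_norm _).
rewrite (normal_pdfE _ s20) pE /normal_fun subr0.
have peak0 : normal_peak (2 * s) != 0 by rewrite gt_eqF// normal_peak_gt0.
have -> a : K * (normal_peak (2 * s) * a) = normal_peak s * (A * a).
  by rewrite /K; field.
rewrite mulrCA ler_wpM2l ?normal_peak_ge0//.
pose u := x ^+ 2 / (8 * s ^+ 2).
have -> : - x ^+ 2 / ((2 * s) ^+ 2 *+ 2) = - u.
  by rewrite /u -mulr_natr; field.
have -> : - x ^+ 2 / (s ^+ 2 *+ 2) = - u + - (3 * u).
  by rewrite /u -mulr_natr; field.
rewrite expRD mulrCA [leRHS]mulrC ler_wpM2l ?expR_ge0//.
rewrite expRN ler_pdivrMr ?expR_gt0//.
have u0 : 0 <= u by rewrite /u divr_ge0 ?sqr_ge0// mulr_ge0 ?ltW.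
have xE : x ^+ 2 = u * (8 * s ^+ 2) by rewrite /u divfK// gt_eqF// mulr_gt0.
have h1 := expR_ge1Dx (3 * u).
have A0 : 0 <= A by rewrite /A addr_ge0// divr_ge0// mulr_ge0// ltW.
apply: le_trans (ler_wpM2l A0 h1).
have : 2 * `|x| <= 1 + x ^+ 2.
  rewrite -(real_normK (num_real x)); have := sqr_ge0 (`|x| - 1); lra.
have v0 := s2_gt0; rewrite xE /A; set v := s ^+ 2 in v0 *; nra.
Qed.

Let mtrig (h : R -> R) (t c : R) : continuous h ->
  measurable_fun [set: R] (fun x : R => h (t * x + c)).
Proof.
move=> ch; apply: continuous_measurable_fun => x.
apply: (@continuous_comp _ _ _ (fun x => t * x + c) h); last exact: ch.
by apply: cvgD; [apply: cvgM; [exact: cvg_cst|exact: cvg_id]|exact: cvg_cst].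
Qed.

Let int_trig_p (h : R -> R) (t c : R) : continuous h -> (forall x, `|h x| <= 1) ->
  leb.-integrable [set: R] (EFin \o (fun x => h (t * x + c) * p x)).
Proof.
move=> ch h1; apply: (le_integrable measurableT _ _ int_p).
  by apply/measurable_EFinP/measurable_funM; [exact: mtrig|exact: measurable_normal_pdf].
by move=> x _ /=; rewrite lee_fin normrM ler_piMl.
Qed.

Let int_xtrig_p (h : R -> R) (t c : R) : continuous h -> (forall x, `|h x| <= 1) ->
  leb.-integrable [set: R] (EFin \o (fun x => x * h (t * x + c) * p x)).
Proof.
move=> ch h1; apply: (le_integrable measurableT _ _ int_norm_p).
  apply/measurable_EFinP/measurable_funM; last exact: measurable_normal_pdf.
  by apply: measurable_funM => //; exact: mtrig.
move=> x _ /=; rewrite lee_fin !normrM normr_id ler_wpM2r//.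
by rewrite ler_piMr.
Qed.

Let derive_p (x : R) : is_derive x 1 p (- (x / s ^+ 2) * p x).
Proof.
have -> : p = fun x => normal_peak s * expR (- x ^+ 2 / (s ^+ 2 *+ 2)).
  by apply/funext => y; exact: pE.
apply: is_derive_eq; rewrite /GRing.scale/=.
rewrite -[_ *+ 2]mulr_natr; field.
exact: s0.
Qed.

(** Integrate the derivative of sin (t * x + c) * p x, where the density satisfies
    p' x = - x / s^2 * p x. *)
Let by_parts (t c : R) :
  \int[leb]_x (x * sin (t * x + c) * p x) =
  s ^+ 2 * t * \int[leb]_x (cos (t * x + c) * p x).
Proof.
pose f x := t * (cos (t * x + c) * p x) - (s ^+ 2)^-1 * (x * sin (t * x + c) * p x).
have i1 := int_trig_p t c (@continuous_cos R) (@cos_max R).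
have i2 := int_xtrig_p t c (@continuous_sin R) (@sin_max R).
have i1' : leb.-integrable setT (EFin \o (fun x => t * (cos (t * x + c) * p x))).
  exact: (integrableZl measurableT t i1).
have i2' : leb.-integrable setT
    (EFin \o (fun x => (s ^+ 2)^-1 * (x * sin (t * x + c) * p x))).
  exact: (integrableZl measurableT _ i2).
have : \int[leb]_x f x = 0.
  apply: (@integral_derivative_eq0 (fun x => sin (t * x + c) * p x)).
  - move=> x; have dp := derive_p x.
    have ds : is_derive x 1 (fun x : R => sin (t * x + c)) (t * cos (t * x + c)).
      by apply: is_derive_eq; rewrite /GRing.scale/=; ring.
    have := is_deriveM ds dp => /is_derive_eq; apply.
    rewrite /GRing.scale/= /f; field; exact: s0.
  - have cp : continuous p by exact: continuous_normal_pdf.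
    have ca : continuous (fun x : R => t * x + c).
      by move=> y; apply: cvgD; [apply: cvgM; [exact: cvg_cst|exact: cvg_id]|exact: cvg_cst].
    have cc : continuous (fun x : R => cos (t * x + c)).
      by move=> y; apply: (continuous_comp (ca y)); exact: continuous_cos.
    have cs : continuous (fun x : R => sin (t * x + c)).
      by move=> y; apply: (continuous_comp (ca y)); exact: continuous_sin.
    move=> x; apply: cvgB; apply: cvgM; try exact: cvg_cst.
      by apply: cvgM; [exact: cc|exact: cp].
    by apply: cvgM; [apply: cvgM; [exact: cvg_id|exact: cs]|exact: cp].
  - exact: (integrableB measurableT i1' i2').
  - apply/cvgrPdist_le => e e0; near=> n.
    have n1 : 1 <= n%:R :> R by rewrite ler1n; near: n; exists 1%N.
    have n2 : 4 * s ^+ 2 * normal_peak s / e <= n%:R.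
      by near: n; exact: nbhs_infty_ger.
    rewrite sub0r normrN (le_trans (ler_normB _ _))// !normrM.
    have pN : p (- n%:R) = p n%:R by rewrite !pE sqrrN.
    rewrite pN [`|p _|]ger0_norm ?normal_pdf_ge0//.
    apply: le_trans (_ : 2 * p n%:R <= _).
      by rewrite mulr_natl mulr2n lerD// ler_piMl ?normal_pdf_ge0 ?sin_max.
    have s20 := s2_gt0; have pk := normal_peak_ge0 s; have n0 : 0 < n%:R :> R by lra.
    have : p n%:R * (1 + n%:R ^+ 2 / (s ^+ 2 *+ 2)) <= normal_peak s.
      rewrite pE -mulrA ler_piMr// -[leRHS](expRxMexpNx_1 (- n%:R ^+ 2 / (s ^+ 2 *+ 2))).
      by rewrite ler_wpM2l ?expR_ge0// mulNr opprK expR_ge1Dx.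
    rewrite -[_ *+ 2]mulr_natr => h.
    have h2 : p n%:R * n%:R <= normal_peak s * (2 * s ^+ 2).
      have p0 := normal_pdf_ge0 0 s n%:R.
      have nE : n%:R ^+ 2 = (n%:R ^+ 2 / (s ^+ 2 * 2)) * (s ^+ 2 * 2).
        by rewrite divfK// mulf_neq0// lt0r_neq0.
      set w := n%:R ^+ 2 / _ in h nE.
      apply: le_trans (_ : p n%:R * (n%:R ^+ 2) <= _).
        by rewrite ler_wpM2l// expr2 ler_peMl// ltW.
      rewrite nE mulrA [2 * _]mulrC ler_wpM2r//; first by rewrite mulr_ge0// ltW.
      by rewrite (le_trans _ h)// ler_wpM2l// lerDr.
    move: n2; rewrite ler_pdivrMr// -[leRHS]mulrC => n2.
    rewrite -(ler_pM2r n0); lra.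
rewrite /f RintegralB// !RintegralZl// => /eqP.
rewrite subr_eq0 => /eqP h; rewrite -mulrA h mulrA divff ?mul1r//; exact: lt0r_neq0.
Unshelve. all: by end_near.
Qed.


Let phi (c t : R) := \int[leb]_x (cos (t * x + c) * p x).

(** Differentiation under the integral sign turns phi into a solution of a first
    order linear equation, by the integration by parts above. *)
Let derive_phi (c t : R) : is_derive t 1 (phi c) (- (s ^+ 2 * t * phi c t)).
Proof.
have dtrig (x y : R) : is_derive x 1 (fun z : R => cos (z * y + c) * p y)
    (- (y * sin (x * y + c) * p y)).
  apply: is_derive_eq; rewrite /GRing.scale/=; ring.
have d1E : partial1of2 (fun z y : R => cos (z * y + c) * p y) =
    fun x y => - (y * sin (x * y + c) * p y).
  by apply/funext => x; apply/funext => y; rewrite partial1of2E; have [_] := dtrig x y.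
have tI : `]t - 1, t + 1[%classic t by rewrite /= in_itv/=; apply/andP; split; lra.
have Gub x y : `]t - 1, t + 1[%classic x -> [set: R] y ->
    `|partial1of2 (fun z y : R => cos (z * y + c) * p y) x y| <= `|y| * p y.
  move=> _ _; rewrite d1E normrN !normrM ler_pM ?mulr_ge0//.
    by rewrite ler_piMr// sin_max.
  by rewrite ger0_norm// normal_pdf_ge0.
have G0 (y : R) : 0 <= `|y| * p y by rewrite mulr_ge0 ?normal_pdf_ge0.
have intf (x : R) : `]t - 1, t + 1[%classic x ->
    leb.-integrable setT (EFin \o (fun y => cos (x * y + c) * p y)).
  by move=> _; exact: int_trig_p (@continuous_cos R) (@cos_max R).
have derf (x y : R) : `]t - 1, t + 1[%classic x -> [set: R] y ->
    derivable (fun z : R => cos (z * y + c) * p y) x 1.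
  by move=> _ _; have [] := dtrig x y.
apply: DeriveDef.
  exact: (derivable_under_integral measurableT tI intf derf G0 int_norm_p Gub).
rewrite -derive1E (differentiation_under_integral measurableT tI intf derf G0 int_norm_p Gub).
rewrite d1E -by_parts -mulN1r -RintegralZl//; last first.
  exact: int_xtrig_p (@continuous_sin R) (@sin_max R).
by apply: eq_Rintegral => y _; rewrite mulN1r.
Qed.

(** The product of phi with exp (s^2 t^2 / 2) has derivative 0. *)
Lemma mean_cos_normal_prob (t c : R) :
  mean (normal_prob 0 s) (fun x : R => cos (t * x + c)) =
  expR (- ((t * s) ^+ 2 / 2)) * cos c.
Proof.
rewrite integral_normal_prob//; first last.
- by exists 1 => x; exact: cos_max.
- exact: mtrig (@continuous_cos R).
pose psi (u : R) := phi c u * expR (s ^+ 2 * u ^+ 2 / 2).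
have dpsi (u : R) : is_derive u 1 psi 0.
  have d1 := derive_phi c u.
  have d2 : is_derive u 1 (fun u : R => expR (s ^+ 2 * u ^+ 2 / 2))
      (s ^+ 2 * u * expR (s ^+ 2 * u ^+ 2 / 2)).
    by apply: is_derive_eq; rewrite /GRing.scale/=; field.
  have := is_deriveM d1 d2 => /is_derive_eq; apply.
  by rewrite /GRing.scale/=; ring.
have := is_derive_0_is_cst t 0 dpsi; rewrite /psi.
have -> : phi c 0 = cos c.
  rewrite /phi; under eq_Rintegral do rewrite mul0r add0r.
  rewrite RintegralZl//.
  by rewrite /Rintegral integral_normal_pdf mulr1.
rewrite expr0n mulr0 mul0r expR0 mulr1 => <-.
rewrite mulrCA -expRD (_ : _ + _ = 0) ?expR0 ?mulr1//; last by field.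
Qed.

End characteristic_function.
End gaussian.

(** * Bernstein polynomials in a sine coordinate *)

Section bernstein.
Context {R : realType}.
Implicit Types (f : nat -> R) (v x : R).

(** The Bernstein polynomial of f, which is the mean of f over a binomial
    variable.  The recursion conditions on one trial; it gives the polynomial
    without binomial coefficients, and every property by a direct induction. *)
Fixpoint bernstein (N : nat) f v : R :=
  if N is N'.+1 then (1 - v) * bernstein N' f v + v * bernstein N' (f \o succn) v
  else f 0%N.

Lemma ler_bernstein N f h v : 0 <= v <= 1 -> (forall k, (k <= N)%N -> f k <= h k) ->
  bernstein N f v <= bernstein N h v.
Proof.
move=> /andP[v0 v1]; elim: N f h => [|N ih] f h fh /=; first exact: fh.
rewrite lerD// ler_wpM2l ?subr_ge0//; apply: ih => k kN; apply: fh => //.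
exact: leqW.
Qed.

Lemma bernstein_affine N (a b : R) f v :
  bernstein N (fun k => a + b * f k) v = a + b * bernstein N f v.
Proof.
elim: N f => [//|N ih] f /=.
by rewrite ih (ih (f \o succn)); ring.
Qed.

(** Bias and variance of a binomial variable. *)
Lemma bernstein_sqr N v (a : R) :
  bernstein N (fun k => (k%:R - a) ^+ 2) v = (N%:R * v - a) ^+ 2 + N%:R * v * (1 - v).
Proof.
elim: N a => [|N ih] a /=; first by rewrite !mul0r addr0.
rewrite ih; have -> : bernstein N ((fun k => (k%:R - a) ^+ 2) \o succn) v =
    bernstein N (fun k => (k%:R - (a - 1)) ^+ 2) v.
  by congr bernstein; apply/funext => k /=; rewrite -natr1; ring.
rewrite ih -natr1; ring.
Qed.

Lemma uniform_continuity_itv01 (G : R -> R) (e : R) : continuous G -> 0 < e ->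
  exists2 delta, 0 < delta & forall x y, 0 <= x <= 1 -> `|x - y| < delta ->
    `|G x - G y| <= e.
Proof.
move=> cG e0.
have /compact_near_coveringP cov := @segment_compact R 0 1.
have /cov : forall x : R, `[0, 1]%classic x ->
    \forall x' \near x & delta \near (0 : R)^'+,
      forall y, `|x' - y| < delta -> `|G x' - G y| <= e.
  move=> x _.
  have e20 : 0 < e / 2 by lra.
  have := cG x => /cvgrPdist_lt/(_ _ e20)/nbhs_ballP[r /= r0 rG].
  exists (ball x (r / 2), [set delta | delta < r / 2]).
    split; first by apply: nbhsx_ballx; lra.
    by apply: nbhs_right_lt; lra.
  move=> [x' delta] /= [xx' dr] y x'y.
  have h1 := rG x'; have h2 := rG y.
  have := h1 _; have := h2 _ => {h1 h2}.
  rewrite /ball/= in xx' *.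
  move=> /(_ _) h2 /(_ _) h1.
  have {}h1 : `|G x - G x'| < e / 2 by apply: h1; lra.
  have {}h2 : `|G x - G y| < e / 2.
    by apply: h2; have := ler_distD x' x y; lra.
  have := ler_distD (G x) (G x') (G y); rewrite [`|G x' - G x|]distrC; lra.
move=> [r /= r0 rG]; exists (r / 2); first by lra.
move=> x y x01; have := rG (r / 2); apply => //=.
- by rewrite sub0r normrN gtr0_norm; lra.
- by lra.
Qed.

(** Bernstein's proof: G (k / N) is close to G v when k / N is close to v, and the
    variance bound makes the other k improbable (Chebyshev). *)
Lemma bernstein_approx (G : R -> R) (M e : R) : continuous G -> 0 < e -> 0 <= M ->
  (forall x, `|G x| <= M) ->
  exists N : nat, forall v, 0 <= v <= 1 ->
    `|G v - bernstein N (fun k => G (k%:R / N%:R)) v| <= e.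
Proof.
move=> cG e0 M0 GM.
have e20 : 0 < e / 2 by lra.
have [delta d0 dG] := uniform_continuity_itv01 cG e20.
have d2 : 0 < delta ^+ 2 by rewrite exprn_gt0.
pose N := (Num.truncn (4 * M / (delta ^+ 2 * e))).+1.
exists N => v v01; have /andP[v0 v1] := v01.
have N0 : 0 < N%:R :> R by rewrite ltr0n.
have NM : 4 * M / (delta ^+ 2 * e) <= N%:R by apply: ltW; exact: truncnS_gt.
pose b := 2 * M / (delta ^+ 2 * N%:R ^+ 2).
have N20 : 0 < N%:R ^+ 2 :> R by rewrite exprn_gt0.
have b0 : 0 <= b.
  by apply: divr_ge0; [exact: mulr_ge0|rewrite ltW// mulr_gt0].
have close k : `|G v - G (k%:R / N%:R)| <= e / 2 + b * (k%:R - N%:R * v) ^+ 2.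
  have sq0 : 0 <= b * (k%:R - N%:R * v) ^+ 2 by rewrite mulr_ge0// sqr_ge0.
  have [lt|ge] := ltP `|v - k%:R / N%:R| delta.
    by rewrite (le_trans (dG _ _ v01 lt))// lerDl.
  apply: le_trans (_ : M + M <= _).
    by rewrite (le_trans (ler_normB _ _))// lerD.
  have -> : b * (k%:R - N%:R * v) ^+ 2 = (2 * M) * ((v - k%:R / N%:R) ^+ 2 / delta ^+ 2).
    by rewrite /b; field; rewrite ?lt0r_neq0.
  have : 1 <= (v - k%:R / N%:R) ^+ 2 / delta ^+ 2.
    rewrite ler_pdivlMr// mul1r -[leRHS](real_normK (num_real _)).
    by rewrite lerXn2r// nnegrE ltW.
  move: (_ / delta ^+ 2) => q q1; have := ler_wpM2l M0 q1; lra.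
have bE : b * (N%:R * v * (1 - v)) <= e / 2.
  have vv : v * (1 - v) <= 1 by nra.
  have vv0 : 0 <= v * (1 - v) by nra.
  apply: le_trans (_ : b * N%:R <= _).
    by rewrite ler_wpM2l// -mulrA ler_piMr// ltW.
  have -> : b * N%:R = 2 * M / delta ^+ 2 / N%:R.
    by rewrite /b; field; rewrite ?lt0r_neq0.
  rewrite ler_pdivrMr// [e / 2 * _]mulrC -ler_pdivrMr//.
  by apply: le_trans NM; rewrite le_eqVlt; apply/orP; left; apply/eqP; field;
    rewrite ?lt0r_neq0.
have := bernstein_sqr N v (N%:R * v); rewrite subrr expr0n add0r => bs.
rewrite ler_norml; apply/andP; split.
- have : bernstein N (fun k => G (k%:R / N%:R)) v <=
      bernstein N (fun k => (G v + e / 2) + b * (k%:R - N%:R * v) ^+ 2) v.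
    apply: ler_bernstein => // k _; have := close k; rewrite ler_norml => /andP[]; lra.
  by rewrite bernstein_affine bs; lra.
- have : bernstein N (fun k => (G v - e / 2) + (- b) * (k%:R - N%:R * v) ^+ 2) v <=
      bernstein N (fun k => G (k%:R / N%:R)) v.
    apply: ler_bernstein => // k _; have := close k; rewrite ler_norml => /andP[]; lra.
  by rewrite bernstein_affine bs mulNr; lra.
Qed.

Lemma bernstein_bounded N f v (M : R) : 0 <= v <= 1 -> (forall k, `|f k| <= M) ->
  `|bernstein N f v| <= M.
Proof.
move=> v01 fM.
have cst a : bernstein N (fun=> a) v = a.
  have := bernstein_affine N a 0 f v; rewrite mul0r addr0 => h; rewrite -[RHS]h.
  by congr bernstein; apply/funext => k; rewrite mul0r addr0.
rewrite ler_norml; apply/andP; split.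
- rewrite -[leLHS]cst; apply: ler_bernstein => // k _.
  by have := fM k; rewrite ler_norml => /andP[].
- rewrite -[leRHS]cst; apply: ler_bernstein => // k _.
  by have := fM k; rewrite ler_norml => /andP[].
Qed.

End bernstein.

Section sine_coordinate.
Context {R : realType}.

(** On [-K, K] this is a homeomorphism onto a subinterval of [0, 1], so algebraic
    approximation in this coordinate is approximation by trigonometric
    polynomials; and it stays in [0, 1] on the whole line, so the approximants
    are bounded everywhere by the bound of the approximated function. *)
Definition sine_coord (K x : R) : R := (1 + sin (K^-1 * x)) / 2.

Lemma sine_coord01 (K x : R) : 0 <= sine_coord K x <= 1.
Proof.
rewrite /sine_coord; have := sin_geN1 (K^-1 * x); have := sin_le1 (K^-1 * x).
by move=> ? ?; apply/andP; split; lra.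
Qed.

(** Bernstein approximation of g o (K * asin), read in the sine coordinate.  The
    argument of asin is clipped to [- sin 1, sin 1], away from the end points
    of its domain; |x| <= K corresponds to sine values in that range. *)
Lemma sine_approx (g : R -> R) (M K e : R) : continuous g -> 0 < e -> 0 < K ->
  0 <= M -> (forall x, `|g x| <= M) ->
  exists N f, (forall x, `|x| <= K -> `|g x - bernstein N f (sine_coord K x)| <= e) /\
    (forall x, `|bernstein N f (sine_coord K x)| <= M).
Proof.
move=> cg e0 K0 M0 gM.
have pi2 : 1 < pi / 2 :> R.
  rewrite ltNge; apply/negP => pi1.
  have c1 := @cos1_gt0 R; move: pi1; rewrite le_eqVlt => /predU1P[p1|p1].
    by move: c1; rewrite -p1 cos_pihalf ltxx.
  suff : cos (1 : R) < cos (pi / 2) by rewrite cos_pihalf; lra.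
  by rewrite ltr_cos// in_itv/=; have := @pi_ge2 R; have := @pi_gt0 R => ? ?;
    apply/andP; split; lra.
pose s1 : R := sin 1.
have s11 : s1 < 1.
  have := cos2Dsin2 (1 : R); have := @cos1_gt0 R; have := sin_le1 (1 : R).
  by rewrite /s1; nra.
have s10 : 0 < s1.
  by rewrite /s1 sin_gt0_pi//; lra.
pose clip (u : R) := Num.max (- s1) (Num.min s1 u).
have clipB u : -1 < clip u < 1.
  rewrite /clip lt_max gt_max gt_min; apply/andP; split; last first.
    by apply/andP; split; [lra|rewrite s11].
  by apply/orP; left; lra.
have cclip : continuous clip.
  move=> u; apply: (@continuous_max _ _ (fun=> - s1) (fun u => Num.min s1 u)).
    exact: cvg_cst.
  by apply: (@continuous_min _ _ (fun=> s1) id); [exact: cvg_cst|exact: cvg_id].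
pose G (v : R) := g (K * asin (clip (v * 2 - 1))).
have cv : continuous (fun v : R => v * 2 - 1).
  by move=> v; apply: cvgB; [apply: cvgM; [exact: cvg_id|exact: cvg_cst]|exact: cvg_cst].
have ca : continuous (fun v : R => clip (v * 2 - 1)).
  by move=> v; exact: (continuous_comp (cv v) (cclip _)).
have cb : continuous (fun v : R => asin (clip (v * 2 - 1))).
  by move=> v; exact: (continuous_comp (ca v) (continuous_asin (clipB _))).
have cK : continuous (fun v : R => K * asin (clip (v * 2 - 1))).
  by move=> v; apply: cvgM; [exact: cvg_cst|exact: cb].
have cG : continuous G.
  by move=> v; exact: (continuous_comp (cK v) (cg _)).
have [N NP] := bernstein_approx cG e0 M0 (fun v => gM _).
exists N, (fun k => G (k%:R / N%:R)); split; last first.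
  by move=> x; apply: bernstein_bounded; [exact: sine_coord01|move=> k; exact: gM].
move=> x xK; have := NP _ (sine_coord01 K x).
suff -> : G (sine_coord K x) = g x by [].
rewrite /G /sine_coord divfK// [1 + _]addrC addrK.
set y := K^-1 * x.
have y1 : -1 <= y <= 1.
  by rewrite -ler_norml /y normrM gtr0_norm ?invr_gt0// ler_pdivrMl// mulr1.
have /andP[yl yr] := y1.
have ys : - s1 <= sin y <= s1.
  have le_sin a b : -1 <= a -> b <= 1 -> a <= b -> sin a <= sin b :> R.
    move=> a1 b1; rewrite le_eqVlt => /predU1P[->//|ab].
    by rewrite ltW// ltr_sin// in_itv/=; apply/andP; split; lra.
  by rewrite /s1 -sinN !le_sin//; lra.
have -> : clip (sin y) = sin y.
  by have /andP[ysl ysr] := ys; rewrite /clip (min_idPr ysr) (max_idPr ysl).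
rewrite sinK; last by rewrite in_itv/=; apply/andP; split; lra.
by rewrite /y mulrA divff ?mul1r// lt0r_neq0.
Qed.

End sine_coordinate.

(** * Weak convergence from convergence of cosines *)

Section cos_convergence.
Context {R : realType} (d : nat -> measure_display) (T : forall n, measurableType (d n)).
Variables (P : forall n, probability (T n) R) (Z : forall n, T n -> R).
Variable mu : probability (measurableTypeR R) R.
Arguments Z : clear implicits.
Hypothesis measurable_Z : forall n, measurable_fun [set: T n] (Z n).

(** Continuity and boundedness are part of the notion to make it stable under
    linear combinations. *)
Definition cvg_test (q : R -> R) := [/\ continuous q, exists M, forall x, `|q x| <= M &
  mean (P n) (fun w => q (Z n w)) @[n --> \oo] --> mean mu q].

Let int_comp_Z (q : R -> R) (M : R) n : continuous q -> (forall x, `|q x| <= M) ->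
  rintegrable (P n) (fun w => q (Z n w)).
Proof.
move=> cq qM; apply: rintegrable_bounded => //.
have mq : measurable_fun [set: R] q by exact: continuous_measurable_fun.
exact: (measurableT_comp mq).
Qed.

Let int_mu (q : R -> R) (M : R) : continuous q -> (forall x, `|q x| <= M) ->
  rintegrable mu q.
Proof.
by move=> cq qM; apply: (@rintegrable_bounded _ _ _ mu q M _ qM); exact: continuous_measurable_fun.
Qed.

Lemma cvg_test_lincomb (a b : R) (q1 q2 : R -> R) : cvg_test q1 -> cvg_test q2 ->
  cvg_test (fun x => a * q1 x + b * q2 x).
Proof.
move=> [c1 [M1 b1] h1] [c2 [M2 b2] h2]; split.
- by move=> x; apply: cvgD; (apply: cvgM; first exact: cvg_cst); [exact: c1|exact: c2].
- exists (`|a| * M1 + `|b| * M2) => x.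
  by rewrite (le_trans (ler_normD _ _))// !normrM lerD// ler_wpM2l.
have i1 := int_mu c1 b1; have i2 := int_mu c2 b2.
rewrite meanD ?meanZ//; try exact: rintegrableZ.
under eq_fun => n.
  rewrite meanD ?meanZ; [|exact: int_comp_Z b2|exact: int_comp_Z b1| |]; first over.
  - exact/rintegrableZ/(int_comp_Z _ c1 b1).
  - exact/rintegrableZ/(int_comp_Z _ c2 b2).
by apply: cvgD; apply: cvgM => //; exact: cvg_cst.
Qed.

Hypothesis cos_cvg : forall t c : R,
  mean (P n) (fun w => cos (t * Z n w + c)) @[n --> \oo] -->
  mean mu (fun x => cos (t * x + c)).

Let cos_test (t c : R) : cvg_test (fun x => cos (t * x + c)).
Proof.
split; [|by exists 1 => x; exact: cos_max|exact: cos_cvg].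
move=> x; apply: (@continuous_comp _ _ _ (fun x => t * x + c) (@cos R)).
  by apply: cvgD; [apply: cvgM; [exact: cvg_cst|exact: cvg_id]|exact: cvg_cst].
exact: continuous_cos.
Qed.

(** A Bernstein polynomial in the sine coordinate is a combination of cosines:
    each factor sin (x / K) turns cos (t x + c) into a difference of cosines of
    frequencies t + 1/K and t - 1/K.  The induction carries an arbitrary cosine
    along. *)
Lemma cvg_test_bernstein (K : R) N f :
  cvg_test (fun x => bernstein N f (sine_coord K x)).
Proof.
suff H t c : cvg_test (fun x => bernstein N f (sine_coord K x) * cos (t * x + c)).
  have := H 0 0; congr cvg_test; apply/funext => x.
  by rewrite mul0r addr0 cos0 mulr1.
elim: N f t c => [|N ih] f t c /=.
  have := cvg_test_lincomb (f 0%N) 0 (cos_test t c) (cos_test t c).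
  by congr cvg_test; apply/funext => x; rewrite mul0r addr0.
pose q h t' c' x := bernstein N h (sine_coord K x) * cos (t' * x + c').
have sine_mul h : cvg_test (fun x => 2^-1 * q h (t + K^-1) (c - pi / 2) x +
    (- 2^-1) * q h (t - K^-1) (c - pi / 2) x).
  by apply: cvg_test_lincomb; exact: ih.
have plain : cvg_test (fun x => 2^-1 * q f t c x + 2^-1 * q (f \o succn) t c x).
  by apply: cvg_test_lincomb; exact: ih.
have mixed := cvg_test_lincomb (- 2^-1) 2^-1 (sine_mul f) (sine_mul (f \o succn)).
have := cvg_test_lincomb 1 1 plain mixed.
congr cvg_test; apply/funext => x; rewrite /q.
have -> : (t + K^-1) * x + (c - pi / 2) = (t * x + c + K^-1 * x) - pi / 2 by ring.
have -> : (t - K^-1) * x + (c - pi / 2) = (t * x + c - K^-1 * x) - pi / 2 by ring.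
rewrite !cosBpihalf sinD sinB.
set b1 := bernstein _ _ _; set b2 := bernstein _ _ _.
by rewrite /sine_coord; move: (sin (K^-1 * x)) (cos (K^-1 * x)) => u v; field.
Qed.

Lemma mean_trunc_norm_cvg0 : mean mu (fun x => Num.min 1 (`|x| / n.+1%:R)) @[n --> \oo] --> 0.
Proof.
have mtr n : measurable_fun [set: measurableTypeR R] (fun x : R => Num.min 1 (`|x| / n.+1%:R)).
  have mn : measurable_fun [set: R] (fun x : R => `|x|).
    by apply: continuous_measurable_fun; exact: norm_continuous.
  have mn' : measurable_fun [set: R] (fun x : R => `|x| / n.+1%:R).
    by apply: measurable_funM.
  exact: measurable_minr.
have tr0 n (x : R) : 0 <= Num.min 1 (`|x| / n.+1%:R) by rewrite le_min ler01 divr_ge0.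
apply/fine_cvg.
rewrite [X in _ --> X](_ : _ = (\int[mu]_x (cst 0 x))%E); last by rewrite integral_cst// mul0e.
apply: (@dominated_cvg _ _ _ mu setT measurableT
  (fun n x => (Num.min 1 (`|x| / n.+1%:R))%:E) (cst 0%E) (cst 1%E)).
- by move=> n; exact/measurable_EFinP.
- move=> x _; apply: cvg_EFin; first exact: nearW.
  apply/cvgrPdist_le => e e0; near=> n.
  rewrite sub0r normrN /= ger0_norm// ge_min; apply/orP; right.
  rewrite ler_pdivrMr// mulrC -ler_pdivrMr//.
  apply: (@le_trans _ _ n%:R); last by rewrite ler_nat.
  by near: n; exact: nbhs_infty_ger.
- by [].
- exact: (rintegrable_cst mu 1).
- by move=> n x _; rewrite lee_fin ger0_norm// ge_min lexx.
Unshelve. all: by end_near.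
Qed.

Hypothesis Z_sqr_int : forall n, rintegrable (P n) (fun w => Z n w ^+ 2).
Variable B : R.
Hypothesis Z_sqr_le : \forall n \near \oo, mean (P n) (fun w => Z n w ^+ 2) <= B.

(** Convergence of trigonometric means suffices: approximate g on [-K, K] by a
    Bernstein polynomial q in the sine coordinate.  Off this interval g - q is
    bounded, and min(1, |x| / K) controls the mass there, uniformly in n by the
    second moments. *)
Lemma mean_cvg_of_cos (g : R -> R) (M : R) : continuous g -> (forall x, `|g x| <= M) ->
  mean (P n) (fun w => g (Z n w)) @[n --> \oo] --> mean mu g.
Proof.
move=> cg gM.
have M0 : 0 <= M by apply: le_trans (gM 0).
apply/cvgrPdist_le => e e0.
pose e8 := e / 8; have e80 : 0 < e8 by rewrite /e8; lra.
have mu_tail := mean_trunc_norm_cvg0.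
pose a := e8 / (2 * M + 1).
have a0 : 0 < a by rewrite /a divr_gt0//; lra.
have aM : 2 * M * a <= e8.
  by rewrite /a mulrA ler_pdivrMr; lra.
move/cvgrPdist_le : mu_tail => /(_ _ a0) mu_tail.
near \oo => k.
have kB : (1 + B) / a <= k.+1%:R.
  apply: (@le_trans _ _ k%:R); last by rewrite ler_nat.
  by near: k; exact: nbhs_infty_ger.
have tail_mu : mean mu (fun x => Num.min 1 (`|x| / k.+1%:R)) <= a.
  have : `|0 - mean mu (fun x => Num.min 1 (`|x| / k.+1%:R))| <= a by near: k.
  by rewrite sub0r normrN; apply: le_trans; exact: ler_norm.
set K : R := k.+1%:R in kB tail_mu.
have K0 : 0 < K by rewrite ltr0n.
have [N [f [approx qM]]] := sine_approx cg e80 K0 M0 gM.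
set q := fun x => bernstein N f (sine_coord K x) in approx qM.
have [cq _ q_cvg] : cvg_test q := cvg_test_bernstein K N f.
have tr0 (x : R) : 0 <= Num.min 1 (`|x| / K) by rewrite le_min ler01 divr_ge0// ltW.
have close x : `|g x - q x| <= e8 + 2 * M * Num.min 1 (`|x| / K).
  have [xK|Kx] := leP `|x| K.
    by rewrite (le_trans (approx x xK))// lerDl mulr_ge0// mulr_ge0.
  rewrite min_l ?mulr1; last by rewrite ler_pdivlMr// mul1r ltW.
  rewrite (le_trans (ler_normB _ _))//; have := gM x; have := qM x; rewrite /q; lra.
have ctr : continuous (fun x : R => Num.min 1 (`|x| / K)).
  move=> x; apply: (@continuous_min _ _ (fun=> 1) (fun x => `|x| / K)); first exact: cvg_cst.
  by apply: cvgM; [exact: norm_continuous|exact: cvg_cst].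
have tr1 (x : R) : `|Num.min 1 (`|x| / K)| <= 1 by rewrite ger0_norm// ge_min lexx.
have mu_close : `|mean mu g - mean mu q| <= 2 * e8.
  have itr := int_mu ctr tr1.
  have ib : rintegrable mu (fun x => e8 + 2 * M * Num.min 1 (`|x| / K)).
    by apply: rintegrableD; [exact: rintegrable_cst|exact: rintegrableZ].
  rewrite (le_trans (normr_meanB_le (int_mu cg gM) (int_mu cq qM) ib close))//.
  rewrite meanD ?mean_cst ?meanZ//; [|exact: rintegrable_cst|exact: rintegrableZ].
  have : 2 * M * mean mu (fun x => Num.min 1 (`|x| / K)) <= 2 * M * a.
    by rewrite ler_wpM2l// mulr_ge0.
  by lra.
near=> n.
have n_close : `|mean (P n) (fun w => g (Z n w)) - mean (P n) (fun w => q (Z n w))| <= 2 * e8.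
  have itr := int_comp_Z n ctr tr1.
  have ib : rintegrable (P n) (fun w => e8 + 2 * M * Num.min 1 (`|Z n w| / K)).
    by apply: rintegrableD; [exact: rintegrable_cst|exact: rintegrableZ].
  rewrite (le_trans (normr_meanB_le (int_comp_Z n cg gM) (int_comp_Z n cq qM) ib
    (fun w => close (Z n w))))//.
  rewrite meanD ?mean_cst ?meanZ//; [|exact: rintegrable_cst|exact: rintegrableZ].
  have i2 : rintegrable (P n) (fun w => K^-1 * (1 + Z n w ^+ 2)).
    by apply/rintegrableZ/rintegrableD => //; exact: rintegrable_cst.
  have : mean (P n) (fun w => Num.min 1 (`|Z n w| / K)) <= a.
    apply: le_trans (ler_mean itr i2 _) _.
      move=> w; rewrite ge_min; apply/orP; right; rewrite mulrC ler_wpM2l ?invr_ge0 ?ltW//.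
      rewrite -(real_normK (num_real (Z n w))).
      by have := sqr_ge0 (`|Z n w| - 1); have := normr_ge0 (Z n w); nra.
    rewrite meanZ ?meanD ?mean_cst//; [|exact: rintegrable_cst|]; last first.
      by apply: rintegrableD => //; exact: rintegrable_cst.
    rewrite mulrC ler_pdivrMr// mulrC -ler_pdivrMr//; apply: le_trans kB.
    rewrite ler_pM2r ?invr_gt0// lerD2l.
    by near: n.
  move=> h; have : 2 * M * mean (P n) (fun w => Num.min 1 (`|Z n w| / K)) <= 2 * M * a.
    by rewrite ler_wpM2l// mulr_ge0.
  by lra.
have q_close : `|mean mu q - mean (P n) (fun w => q (Z n w))| <= e8.
  by near: n; move/cvgrPdist_le : q_cvg => /(_ _ e80).
rewrite -[mean mu g](subrK (mean mu q)) -addrA (le_trans (ler_normD _ _))//.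
rewrite (_ : mean mu q - mean (P n) (fun w => g (Z n w)) =
  (mean mu q - mean (P n) (fun w => q (Z n w))) -
  (mean (P n) (fun w => g (Z n w)) - mean (P n) (fun w => q (Z n w)))); last by ring.
have := ler_normB (mean mu q - mean (P n) (fun w => q (Z n w)))
  (mean (P n) (fun w => g (Z n w)) - mean (P n) (fun w => q (Z n w))).
move: mu_close n_close q_close; rewrite /e8; lra.
Unshelve. all: by end_near.
Qed.

End cos_convergence.

(** * Weak dependence of the partial sums of a row *)

Lemma covariance_mean d (T : measurableType d) (R : realType) (P : probability T R)
    (f g : T -> R) : rintegrable P f -> rintegrable P g ->
  rintegrable P (fun w => f w * g w) ->
  covariance P f g = (mean P (fun w => f w * g w) - mean P f * mean P g)%:E.
Proof.
move=> intf intg intfg; rewrite covarianceE; try exact/Lfun1_integrable.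
by rewrite !mean_EFin.
Qed.

Section row.
Context {d : measure_display} {T : measurableType d} {R : realType}.
Variables (P : probability T R) (X : nat -> {RV P >-> R}) (n : nat) (C : R).
Variable theta : nat -> R.
Hypothesis C_ge0 : 0 <= C.
Hypothesis X_centered : forall k, (1 <= k <= n)%N -> 'E_P[X k]%E = 0%E.
Hypothesis X_moment2 : forall k, (1 <= k <= n)%N ->
  ('E_P[fun w => (X k w ^+ 2)%R] <= C%:E)%E.
Hypothesis theta_ge0 : forall r, (0 < r)%N -> 0 <= theta r.
Hypothesis X_weak_dependence :
  forall (u : nat) (s : 'I_u.+1 -> nat) (r t1 t2 : nat),
    (1 <= s ord0)%N ->
    (forall i j : 'I_u.+1, (i < j)%N -> (s i < s j)%N) ->
    (1 <= r)%N -> t1 = (s ord_max + r)%N -> (t1 <= t2)%N -> (t2 <= n)%N ->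
    (forall f : u.+1.-tuple R -> R, measurable_fun [set: u.+1.-tuple R] f ->
       ('E_P[fun w => (f (subvector X s w) ^+ 2)%R] < +oo)%E ->
       (`|covariance P (f \o subvector X s) (X t1)| <=
        (Num.sqrt (fine 'E_P[fun w => (f (subvector X s w) ^+ 2)%R])
           * theta r)%:E)%E)
    /\
    (forall f : u.+1.-tuple R -> R, measurable_fun [set: u.+1.-tuple R] f ->
       bounded_fun f ->
       (`|covariance P (f \o subvector X s)
            (fun w => (X t1 w * X t2 w)%R)| <=
        (sup_norm f * theta r)%:E)%E).

(** With the value 0 outside of the row, all bounds below hold at every index. *)
Definition row k w := if (1 <= k <= n)%N then X k w else 0.

Lemma row_in k : (1 <= k <= n)%N -> row k = X k.
Proof. by move=> kn; apply/funext => w; rewrite /row kn. Qed.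

Lemma row_out k : ~~ (1 <= k <= n)%N -> row k = fun=> 0.
Proof. by move=> /negbTE kn; apply/funext => w; rewrite /row kn. Qed.

Lemma measurable_row k : measurable_fun [set: T] (row k).
Proof.
have [kn|kn] := boolP (1 <= k <= n)%N; first by rewrite row_in.
by rewrite row_out.
Qed.

Lemma row_sqr_int k : rintegrable P (fun w => row k w ^+ 2).
Proof.
have [kn|kn] := boolP (1 <= k <= n)%N; last first.
  rewrite row_out//; under eq_fun do rewrite expr0n; exact: rintegrable_cst.
rewrite row_in//; apply/integrableP; split.
  by apply/measurable_EFinP; exact: measurable_funX.
under eq_integral do rewrite /= ger0_norm ?sqr_ge0//.
apply: (@le_lt_trans _ _ C%:E); last exact: ltry.
by have := X_moment2 kn; rewrite unlock.
Qed.

Lemma row_int k : rintegrable P (row k).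
Proof. by apply: rintegrable_sqr; [exact: measurable_row|exact: row_sqr_int]. Qed.

Lemma row_sqr_le k : mean P (fun w => row k w ^+ 2) <= C.
Proof.
have [kn|kn] := boolP (1 <= k <= n)%N; last first.
  rewrite row_out// (@eq_mean _ _ _ _ _ (fun=> 0)) ?mean_cst// => w.
  by rewrite expr0n.
have := X_moment2 kn; rewrite mean_EFin ?lee_fin ?row_in//.
by have := row_sqr_int k; rewrite row_in.
Qed.

Lemma row_centered k : mean P (row k) = 0.
Proof.
have [kn|kn] := boolP (1 <= k <= n)%N; last by rewrite row_out// mean_cst.
have := X_centered kn; rewrite mean_EFin ?row_in//; first by move=> [].
by have := row_int k; rewrite row_in.
Qed.

Lemma row_mul_int k l : rintegrable P (fun w => row k w * row l w).
Proof.
by apply: rintegrable_mul; try exact: measurable_row; exact: row_sqr_int.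
Qed.

Let sqrtC_le : Num.sqrt C <= 1 + C.
Proof.
rewrite -[leRHS]ger0_norm; last by have := C_ge0; lra.
by have := C_ge0; rewrite -sqrtr_sqr ler_wsqrtr// expr2; nra.
Qed.

(** Weak dependence for one past variable and f the identity. *)
Lemma row_cov_pair k j : (0 < j)%N ->
  `|mean P (fun w => row k w * row (k + j)%N w)| <= Num.sqrt C * theta j.
Proof.
move=> j0; have b0 : 0 <= Num.sqrt C * theta j by rewrite mulr_ge0// theta_ge0.
have [kn|kn] := boolP (1 <= k <= n)%N; last first.
  rewrite row_out// (@eq_mean _ _ _ _ _ (fun=> 0)) ?mean_cst ?normr0// => w.
  by rewrite mul0r.
have [kjn|kjn] := boolP (1 <= k + j <= n)%N; last first.
  rewrite [row (k + j)]row_out// (@eq_mean _ _ _ _ _ (fun=> 0)) ?mean_cst ?normr0// => w.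
  by rewrite mulr0.
have /andP[k1 _] := kn; have /andP[_ kj] := kjn.
have incr (i i' : 'I_1) : (i < i')%N -> (k < k)%N by rewrite !ord1.
have [h _] := @X_weak_dependence 0 (fun=> k) j (k + j)%N (k + j)%N
  k1 incr j0 erefl (leqnn _) kj.
pose f (x : 1.-tuple R) := tnth x ord0.
have fE w : f (subvector X (fun=> k) w) = row k w.
  by rewrite /f /subvector tnth_mktuple row_in.
have := h f (measurable_tnth _).
under [X in ('E_P[X] < _)%E]eq_fun do rewrite fE.
under [X in fine 'E_P[X]]eq_fun do rewrite fE.
rewrite (mean_EFin (row_sqr_int k)) ltry => /(_ isT)/=.
have -> : f \o subvector X (fun=> k) = row k by apply/funext => w /=; exact: fE.
rewrite -(row_in kjn) covariance_mean; try exact: row_int; last exact: row_mul_int.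
rewrite !row_centered mulr0 subr0 lee_fin => /le_trans; apply.
by rewrite ler_wpM2r ?theta_ge0// ler_wsqrtr// row_sqr_le.
Qed.


(* The times 1, .., m; the tuple of all past variables is indexed by them. *)
Let past_tuple m := (fun i : 'I_m => i.+1).

Let past_incr m (i j : 'I_m.+1) : (i < j)%N -> (past_tuple i < past_tuple j)%N.
Proof. by []. Qed.

Let past_tnth m (i : 'I_m.+1) w : (m.+1 <= n)%N ->
  tnth (subvector X (@past_tuple m.+1) w) i = row i.+1 w.
Proof.
move=> mn; rewrite /subvector tnth_mktuple row_in//=.
by have := ltn_ord i; lia.
Qed.

Let row0 w : row 0 w = 0.
Proof. by rewrite row_out. Qed.

Variables (a c : R).

Let psum_past m (w : T) : (m.+1 <= n)%N ->
  \sum_(i < m.+1) tnth (subvector X (@past_tuple m.+1) w) i = psum row m.+1 w.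
Proof.
move=> mn; rewrite /psum [RHS]big_ord_recl row0 add0r.
by apply: eq_bigr => i _; rewrite past_tnth.
Qed.

Let psum_past_pred m (w : T) : (m.+1 <= n)%N ->
  \sum_(i < m) tnth (subvector X (@past_tuple m.+1) w) (widen_ord (leqnSn m) i) =
  psum row m w.
Proof.
move=> mn; rewrite /psum [RHS]big_ord_recl row0 add0r.
by apply: eq_bigr => i _; rewrite past_tnth.
Qed.

Let measurable_affine_sum (h : R -> R) (u : nat) (I : finType) (e : I -> 'I_u) :
  continuous h ->
  measurable_fun [set: u.-tuple R] (fun x => h (a * \sum_i tnth x (e i) + c)).
Proof.
move=> ch; have mh : measurable_fun [set: R] h by exact: continuous_measurable_fun.
apply: (measurableT_comp mh); apply: measurable_funD => //.
apply: measurable_funM => //; apply: measurable_sum => i; exact: measurable_tnth.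
Qed.

Let measurable_row_psum (h : R -> R) m : continuous h ->
  measurable_fun [set: T] (fun w => h (a * psum row m w + c)).
Proof.
move=> ch; have mh : measurable_fun [set: R] h by exact: continuous_measurable_fun.
apply: (measurableT_comp mh); apply: measurable_funD => //.
apply: measurable_funM => //; apply: measurable_psum; exact: measurable_row.
Qed.

(** The function f of the past is an increment of the sine; since sin is
    1-Lipschitz, its second moment is at most a^2 * C. *)
Lemma row_cov_sin k j : (0 < j)%N ->
  `|mean P (fun w => (sin (a * psum row k w + c) - sin (a * psum row k.-1 w + c)) *
                     row (k + j)%N w)| <= `|a| * Num.sqrt C * theta j.
Proof.
move=> j0; have b0 : 0 <= `|a| * Num.sqrt C * theta j by rewrite !mulr_ge0// theta_ge0.
case: k => [|m].
  by rewrite (@eq_mean _ _ _ _ _ (fun=> 0)) ?mean_cst ?normr0// => w; rewrite subrr mul0r.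
have [kjn|kjn] := boolP (1 <= m.+1 + j <= n)%N; last first.
  rewrite [row (m.+1 + j)]row_out// (@eq_mean _ _ _ _ _ (fun=> 0)) ?mean_cst ?normr0// => w.
  by rewrite mulr0.
have /andP[_ kj] := kjn; have mn : (m.+1 <= n)%N by lia.
have [h _] := @X_weak_dependence m (@past_tuple m.+1) j (m.+1 + j)%N (m.+1 + j)%N
  isT (@past_incr m) j0 erefl (leqnn _) kj.
pose f (x : m.+1.-tuple R) := sin (a * (\sum_i tnth x (id i)) + c) -
  sin (a * (\sum_(i < m) tnth x (widen_ord (leqnSn m) i)) + c).
pose D w := sin (a * psum row m.+1 w + c) - sin (a * psum row m w + c).
have fE w : f (subvector X (@past_tuple m.+1) w) = D w.
  by rewrite /f /D psum_past// psum_past_pred.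
have mf : measurable_fun [set: m.+1.-tuple R] f.
  by apply: measurable_funB; exact: measurable_affine_sum (@continuous_sin R).
have mD : measurable_fun [set: T] D.
  by apply: measurable_funB; exact: measurable_row_psum (@continuous_sin R).
have D_le w : `|D w| <= `|a| * `|row m.+1 w|.
  rewrite (le_trans (sin_dist_le _ _))// -normrM psumS le_eqVlt; apply/orP; left.
  by apply/eqP; congr `|_|; ring.
have D_int : rintegrable P D.
  apply: (rintegrable_le mD D_le); apply/rintegrableZ/rintegrable_norm; exact: row_int.
have D_sqr_le w : D w ^+ 2 <= a ^+ 2 * row m.+1 w ^+ 2.
  rewrite -exprMn -[leLHS](real_normK (num_real _)) -[leRHS](real_normK (num_real _)).
  by rewrite lerXn2r ?nnegrE// normrM.
have iaX : rintegrable P (fun w => a ^+ 2 * row m.+1 w ^+ 2).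
  by apply: rintegrableZ; exact: row_sqr_int.
have D_sqr_int : rintegrable P (fun w => D w ^+ 2).
  apply: rintegrable_le iaX => [|w]; first exact: measurable_funX.
  by rewrite ger0_norm ?sqr_ge0.
have := h f mf.
under [X in ('E_P[X] < _)%E]eq_fun do rewrite fE.
under [X in fine 'E_P[X]]eq_fun do rewrite fE.
rewrite (mean_EFin D_sqr_int) ltry => /(_ isT)/=.
have -> : f \o subvector X (@past_tuple m.+1) = D by apply/funext => w /=; exact: fE.
have DX_int : rintegrable P (fun w => D w * row (m.+1 + j)%N w).
  by apply: rintegrable_mul => //; [exact: measurable_row|exact: row_sqr_int].
rewrite -(row_in kjn) covariance_mean//; last exact: row_int.
rewrite row_centered mulr0 subr0 lee_fin => /le_trans; apply.
rewrite ler_wpM2r ?theta_ge0// -sqrtr_sqr -sqrtrM ?sqr_ge0// ler_wsqrtr//.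
apply: le_trans (ler_mean D_sqr_int iaX D_sqr_le) _.
by rewrite meanZ ?ler_wpM2l ?sqr_ge0 ?row_sqr_le//; exact: row_sqr_int.
Qed.

Lemma row_cov_cos m r b : (0 < r)%N -> (m + r <= b)%N ->
  `|mean P (fun w => cos (a * psum row m w + c) * (row (m + r)%N w * row b w)) -
    mean P (fun w => cos (a * psum row m w + c)) *
    mean P (fun w => row (m + r)%N w * row b w)| <= theta r.
Proof.
move=> r0 mrb; have b0 := theta_ge0 r0.
have [bn|nb] := leqP b n; last first.
  rewrite [row b]row_out; last by lia.
  rewrite [X in X - _](_ : _ = 0); last first.
    by rewrite -[RHS](mean_cst P); apply: eq_mean => w; rewrite !mulr0.
  rewrite [X in _ * X](_ : _ = 0) ?mulr0 ?subr0 ?normr0//.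
  by rewrite -[RHS](mean_cst P); apply: eq_mean => w; rewrite !mulr0.
case: m mrb => [|m] mrb.
  have c0 w : cos (a * psum row 0 w + c) = cos c.
    by rewrite /psum big_ord1 row0 mulr0 add0r.
  under [X in mean P X * _]eq_fun do rewrite c0.
  rewrite mean_cst; under [X in mean P X - _]eq_fun do rewrite c0.
  by rewrite meanZ ?subrr ?normr0//; exact: row_mul_int.
have mrn : (1 <= m.+1 + r <= n)%N by lia.
have bn' : (1 <= b <= n)%N by lia.
have [_ h] := @X_weak_dependence m (@past_tuple m.+1) r (m.+1 + r)%N b
  isT (@past_incr m) r0 erefl mrb bn.
pose f (x : m.+1.-tuple R) := cos (a * (\sum_i tnth x (id i)) + c).
have f1 x : `|f x| <= 1 by exact: cos_max.
have mf : measurable_fun [set: m.+1.-tuple R] f.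
  exact: measurable_affine_sum (@continuous_cos R).
have bf : bounded_fun f.
  by exists 1; split; [exact: num_real|move=> M /ltW M1 x _; exact: le_trans (f1 x) M1].
have := h f mf bf.
have -> : f \o subvector X (@past_tuple m.+1) = fun w => cos (a * psum row m.+1 w + c).
  by apply/funext => w; rewrite /= /f psum_past//; lia.
have mc := measurable_row_psum m.+1 (@continuous_cos R).
rewrite -(row_in mrn) -(row_in bn') covariance_mean; first last.
- apply: (rintegrable_mulb mc) (row_mul_int _ _) => w; exact: cos_max.
- exact: row_mul_int.
- by apply: (rintegrable_bounded _ mc (M := 1)) => w; exact: cos_max.
rewrite lee_fin => /le_trans; apply.
rewrite ler_piMl//; apply: sup_le_ub.
  by exists `|f [tuple 0 | i < m.+1]|, [tuple 0 | i < m.+1].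
by move=> _ [x _ <-]; exact: f1.
Qed.


Lemma psum_scale m w : psum (fun k w => a * row k w) m w = a * psum row m w.
Proof. by rewrite /psum mulr_sumr. Qed.

(** Here a stands for t / sqrt n and delta for a multiple of 1/n that dominates
    the three weak dependence bounds of the scaled row. *)
Lemma row_cos_mean_close (delta B tau : R) (dd : nat) : 0 < delta ->
  a ^+ 2 * (1 + C) <= delta ->
  (forall r r', (0 < r)%N -> (r <= r')%N -> theta r' <= theta r) ->
  (forall N, \sum_(1 <= j < N) theta j <= B) ->
  (forall N, \sum_(dd.+1 <= j < N) theta j <= tau) ->
  delta * (1 + 2 * B) <= 1 ->
  `|mean P (fun w => cos (a * psum row n w + c)) -
    expR (- (a ^+ 2 * mean P (fun w => psum row n w ^+ 2) / 2)) * cos c| <=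
  expR (n%:R * delta * (1 + 2 * B)) *
  ((8 * dd + 5)%:R * (3 * dd).+1%:R ^+ 4 *
     \sum_(k < n.+1) mean P (fun w => trunc_sqr (a * row k w)) +
   n%:R * delta * (4 * dd.+1%:R * ((3 * dd).+1%:R * Num.sqrt delta) + 3 * tau
                   + delta * (1 + 2 * B) ^+ 2)).
Proof.
move=> delta0 a2 theta_noninc hB htau dB.
have aC : a ^+ 2 * C <= delta.
  by apply: le_trans a2; rewrite ler_wpM2l ?sqr_ge0// lerDr.
have a1 : a ^+ 2 <= delta by apply: le_trans a2; rewrite ler_peMr ?sqr_ge0// lerDl.
have asC : a ^+ 2 * Num.sqrt C <= delta.
  by apply: le_trans a2; rewrite ler_wpM2l ?sqr_ge0.
have iY2 k : rintegrable P (fun w => (a * row k w) ^+ 2).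
  by under eq_fun do rewrite exprMn; apply: rintegrableZ; exact: row_sqr_int.
have YYE k l f : rintegrable P (fun w => f w * (row k w * row l w)) ->
    mean P (fun w => f w * (a * row k w * (a * row l w))) =
    a ^+ 2 * mean P (fun w => f w * (row k w * row l w)).
  by move=> intf; rewrite -meanZ//; apply: eq_mean => w; ring.
have YYE1 k l : mean P (fun w => a * row k w * (a * row l w)) =
    a ^+ 2 * mean P (fun w => row k w * row l w).
  by rewrite -meanZ; [apply: eq_mean => w; ring|exact: row_mul_int].
have cosE m : (fun w => cos (psum (fun k w => a * row k w) m w + c)) =
    (fun w => cos (a * psum row m w + c)).
  by apply/funext => w; rewrite psum_scale.
have mcos m := measurable_row_psum m (@continuous_cos R).
have := @cos_mean_close _ T R P (fun k w => a * row k w) c delta theta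
  _ _ iY2 delta0 _ _ theta_ge0 _ _ _ B tau dd n theta_noninc hB htau dB.
rewrite cosE.
have -> : mean P (fun w => psum (fun k w => a * row k w) n w ^+ 2) =
    a ^+ 2 * mean P (fun w => psum row n w ^+ 2).
  rewrite -meanZ; last by apply: psum_sqr_int; [exact: measurable_row|exact: row_sqr_int].
  by apply: eq_mean => w; rewrite psum_scale exprMn.
apply.
- by move=> k; apply: measurable_funM => //; exact: measurable_row.
- by move=> w; rewrite row0 mulr0.
- move=> k; apply: le_trans aC; under [X in mean P X]eq_fun do rewrite exprMn.
  by rewrite meanZ ?ler_wpM2l ?sqr_ge0 ?row_sqr_le//; exact: row_sqr_int.
- by move=> k; rewrite meanZ ?row_centered ?mulr0//; exact: row_int.
- move=> k j j0; rewrite YYE1 normrM ger0_norm ?sqr_ge0//.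
  apply: le_trans (ler_wpM2l (sqr_ge0 a) (row_cov_pair k j0)) _.
  by rewrite mulrA ler_wpM2r// theta_ge0.
- move=> k j j0; apply: le_trans (_ : `|a| * (`|a| * Num.sqrt C * theta j) <= _).
    rewrite (_ : mean P _ = a * mean P (fun w => (sin (a * psum row k w + c) -
      sin (a * psum row k.-1 w + c)) * row (k + j)%N w)).
      by rewrite normrM ler_wpM2l// row_cov_sin.
    rewrite -meanZ; first by apply: eq_mean => w; rewrite !psum_scale; ring.
    apply: (@rintegrable_mulb _ _ _ P _ _ 2); last exact: row_int.
      by apply: measurable_funB; exact: measurable_row_psum (@continuous_sin R).
    move=> w; rewrite (le_trans (ler_normB _ _))// (_ : 2 = 1 + 1)//.
    by rewrite lerD ?sin_max.
  by rewrite !mulrA -expr2 real_normK ?num_real// ler_wpM2r// theta_ge0.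
- move=> m r b r0 mrb.
  have iw : rintegrable P (fun w => cos (a * psum row m w + c) *
      (row (m + r)%N w * row b w)).
    by apply: (rintegrable_mulb (mcos m)) (row_mul_int _ _) => w; exact: cos_max.
  rewrite cosE YYE1 (_ : mean P _ = a ^+ 2 * mean P (fun w =>
      cos (a * psum row m w + c) * (row (m + r)%N w * row b w))); last first.
    by rewrite -YYE//; apply: eq_mean => w; rewrite psum_scale.
  rewrite mulrCA -mulrBr normrM ger0_norm ?sqr_ge0//.
  by apply: ler_pM => //; [exact: sqr_ge0|exact: row_cov_cos].
Qed.

End row.

(** * Summable rates and the Lindeberg condition *)

Section summable_rate.
Context {R : realType} (theta : nat -> R).
Hypothesis theta_noninc : forall r r' : nat,
  (1 <= r)%N -> (r <= r')%N -> theta r' <= theta r.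
Hypothesis theta_summable : cvgn (series (fun r => theta r.+1)).

(** A nonincreasing sequence lies above its limit, which is 0. *)
Lemma rate_ge0 r : (0 < r)%N -> 0 <= theta r.
Proof.
case: r => // r _; pose u k := theta k.+1.
have u0 : u n @[n --> \oo] --> 0 by exact: cvg_series_cvg_0.
have nu : nonincreasing_seq u by move=> m n mn; exact: theta_noninc.
have := nonincreasing_cvgn_ge nu (cvgP _ u0) r.
by rewrite (cvg_lim _ u0).
Qed.

Lemma rate_tail d N : \sum_(d.+1 <= j < N) theta j <=
  limn (series (fun r => theta r.+1)) - series (fun r => theta r.+1) d.
Proof.
have nds : nondecreasing_seq (series (fun r => theta r.+1)).
  by apply/nondecreasing_seqP => n; rewrite /series/= big_nat_recr//= lerDl rate_ge0.
have le_lim n := nondecreasing_cvgn_le nds theta_summable n.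
rewrite big_add1; have [dN|Nd] := leqP d N.-1; last first.
  by rewrite big_geq ?subr_ge0; [exact: le_lim|exact: ltnW].
rewrite lerBrDl; apply: le_trans (le_lim N.-1); rewrite /series/=.
by rewrite [in leRHS](big_cat_nat (n := d))//=.
Qed.

Lemma rate_sum_le : exists B, forall N, \sum_(1 <= j < N) theta j <= B.
Proof. by eexists => N; exact: (rate_tail 0 N). Qed.

Lemma rate_tail_small (tau : R) : 0 < tau ->
  exists dd, forall N, \sum_(dd.+1 <= j < N) theta j <= tau.
Proof.
move=> tau0; have /cvgrPdist_le/(_ _ tau0)[dd _ h] := theta_summable.
exists dd => N; apply: le_trans (rate_tail dd N) _.
exact: le_trans (ler_norm _) (h dd (leqnn dd)).
Qed.

End summable_rate.

Section row_limits.
Context {d : measure_display} {T : measurableType d} {R : realType}.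
Variables (P : probability T R) (X : nat -> {RV P >-> R}) (n : nat) (C : R).
Hypothesis X_moment2 : forall k, (1 <= k <= n)%N ->
  ('E_P[fun w => (X k w ^+ 2)%R] <= C%:E)%E.

Hypothesis C_ge0 : 0 <= C.

Local Notation large eps k := [set w' | eps < `|X k w'| / Num.sqrt n%:R].

Lemma psum_row w : psum (row X n) n w = \sum_(1 <= k < n.+1) X k w.
Proof.
rewrite /psum big_ord_recl {1}/row add0r big_add1 big_mkord.
by apply: eq_bigr => k _; rewrite /row lift0 /= ltn_ord.
Qed.

Lemma large_int eps k : (1 <= k <= n)%N ->
  rintegrable P (fun w => X k w ^+ 2 * \1_(large eps k) w).
Proof.
move=> kn; have iX := row_sqr_int X_moment2 k; rewrite row_in// in iX.
apply: rintegrable_le iX => [|w].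
  apply: measurable_funM; first exact: measurable_funX.
  apply: measurable_indic.
  have mf : measurable_fun [set: T] (fun w => `|X k w| / Num.sqrt n%:R).
    by apply: measurable_funM => //; exact: measurableT_comp.
  rewrite [X in measurable X](_ : _ =
    [set: T] `&` (fun w => `|X k w| / Num.sqrt n%:R) @^-1` `]eps, +oo[%classic).
    by apply: mf => //; exact: measurable_itv.
  by apply/seteqP; split => w /=; rewrite in_itv/= andbT => // -[].
rewrite normrM ger0_norm ?sqr_ge0// ler_piMr ?sqr_ge0//.
by rewrite indicE; case: (_ \in _); rewrite ?normr1// normr0.
Qed.

(** Split at |X| / sqrt n = eps: below, the truncated square is at most eps times
    the square; above, it is at most the square, which the Lindeberg condition
    controls. *)
Lemma row_trunc_sqr_le (t eps : R) : (0 < n)%N -> 0 < eps ->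
  \sum_(k < n.+1) mean P (fun w => trunc_sqr (t * (Num.sqrt n%:R)^-1 * row X n k w)) <=
  (1 + `|t|) ^+ 3 * (eps * C +
   n%:R^-1 * \sum_(1 <= k < n.+1) mean P (fun w => X k w ^+ 2 * \1_(large eps k) w)).
Proof.
move=> n0 eps0; have nR : 0 < n%:R :> R by rewrite ltr0n.
have sn : 0 < Num.sqrt n%:R :> R by rewrite sqrtr_gt0.
have t3 : 0 <= (1 + `|t|) ^+ 3 by rewrite exprn_ge0// addr_ge0.
rewrite big_ord_recl [X in X + _](_ : _ = 0); last first.
  rewrite -[RHS](mean_cst P); apply: eq_mean => w.
  by rewrite row_out// mulr0 /trunc_sqr expr0n mulr0.
rewrite add0r big_add1 big_mkord/=.
apply: (@le_trans _ _ (\sum_(k < n) (1 + `|t|) ^+ 3 * (eps * C / n%:R +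
   n%:R^-1 * mean P (fun w => X k.+1 w ^+ 2 * \1_(large eps k.+1) w)))); last first.
  rewrite -mulr_sumr ler_wpM2l// big_split/= sumr_const card_ord -mulr_sumr.
  by rewrite -[X in X + _ <= _]mulr_natr divfK// lt0r_neq0.
apply: ler_sum => k _.
have kn : (1 <= bump 0 k <= n)%N by rewrite /bump/=; have := ltn_ord k; lia.
rewrite row_in//.
have iX := row_sqr_int X_moment2 (bump 0 k); rewrite row_in// in iX.
have iL := large_int eps kn.
have ib : rintegrable P (fun w => (1 + `|t|) ^+ 3 * (eps / n%:R * X (bump 0 k) w ^+ 2 +
    n%:R^-1 * (X (bump 0 k) w ^+ 2 * \1_(large eps (bump 0 k)) w))).
  by apply/rintegrableZ/rintegrableD; exact: rintegrableZ.
have iT : rintegrable P (fun w => trunc_sqr (t * (Num.sqrt n%:R)^-1 * X (bump 0 k) w)).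
  apply: trunc_sqr_int; first exact: measurable_funM.
  by under eq_fun do rewrite exprMn; exact: rintegrableZ.
apply: le_trans (ler_mean iT ib _) _.
  move=> w; set y := (Num.sqrt n%:R)^-1 * X (bump 0 k) w.
  rewrite -mulrA -/y.
  apply: (@le_trans _ _ ((1 + `|t|) ^+ 3 * trunc_sqr y)).
    apply: (@le_trans _ _ (trunc_sqr ((1 + `|t|) * y))).
      apply: le_trunc_sqr; rewrite !normrM ler_wpM2r// [leRHS]ger0_norm ?addr_ge0//.
      by rewrite lerDr.
    by apply: trunc_sqrM; rewrite lerDl.
  rewrite ler_wpM2l//.
  have y2 : y ^+ 2 = n%:R^-1 * X (bump 0 k) w ^+ 2.
    by rewrite /y exprMn exprVn sqr_sqrtr// ltW.
  have yn : `|y| = `|X (bump 0 k) w| / Num.sqrt n%:R.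
    by rewrite /y normrM mulrC [`|_^-1|]ger0_norm// invr_ge0 ltW.
  rewrite -[eps / _ * _]mulrA [n%:R^-1 * (_ * \1__ _)]mulrA -!y2 /trunc_sqr.
  have y20 := sqr_ge0 y.
  have [small|big] := leP `|y| eps.
    rewrite -[leLHS]addr0 lerD//.
      by rewrite ler_wpM2r// ge_min small orbT.
    by rewrite mulr_ge0// indicE.
  rewrite -[leLHS]add0r lerD//; first by rewrite mulr_ge0// ltW.
  rewrite indicE mem_set/=; last by rewrite -yn.
  by rewrite mulr1 ler_piMl// ge_min lexx.
rewrite meanZ; last by apply: rintegrableD; exact: rintegrableZ.
rewrite ler_wpM2l// meanD ?meanZ//; try exact: rintegrableZ.
rewrite /bump/= add1n lerD2r mulrAC ler_wpM2r ?invr_ge0 ?ler0n//.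
rewrite ler_wpM2l ?(ltW eps0)//.
by have := row_sqr_le C_ge0 X_moment2 (bump 0 k); rewrite row_in.
Qed.

End row_limits.

(** * The central limit theorem *)

Theorem theorem6p1 (R : realType) (d : nat -> measure_display)
    (T : forall n, measurableType (d n)) (P : forall n, probability (T n) R)
    (X : forall n : nat, nat -> {RV (P n) >-> R})
    (C sigma : R) (n0 : nat) (theta : nat -> R)
    (X_stationary : forall n, stationary_row n (X n))
    (X_centered : forall n k, (1 <= k <= n)%N -> 'E_(P n)[X n k]%E = 0%E)
    (X_moment2 : forall n k, (1 <= k <= n)%N ->
       ('E_(P n)[fun w => (X n k w ^+ 2)%R] <= C%:E)%E)
    (X_lindeberg : forall eps : R, 0 < eps ->
       (n%:R^-1%:E * \sum_(1 <= k < n.+1)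
          'E_(P n)[fun w => (X n k w ^+ 2 *
             \1_[set w' | eps < `|X n k w'| / Num.sqrt n%:R] w)%R])%E
         @[n --> \oo] --> 0%E)
    (sigma_ge0 : 0 <= sigma)
    (X_variance :
       ('V_(P n)[fun w => (\sum_(1 <= k < n.+1) X n k w)%R] * n%:R^-1%:E)%E
         @[n --> \oo] --> (sigma ^+ 2)%:E)
    (theta_nonincreasing : forall r r' : nat,
       (1 <= r)%N -> (r <= r')%N -> theta r' <= theta r)
    (theta_summable : cvgn (series (fun r => theta r.+1)))
    (X_weak_dependence : forall n : nat, (n0 <= n)%N ->
       forall (u : nat) (s : 'I_u.+1 -> nat) (r t1 t2 : nat),
         (1 <= s ord0)%N ->
         (forall i j : 'I_u.+1, (i < j)%N -> (s i < s j)%N) ->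
         (1 <= r)%N -> t1 = (s ord_max + r)%N -> (t1 <= t2)%N -> (t2 <= n)%N ->
         (forall f : u.+1.-tuple R -> R, measurable_fun [set: u.+1.-tuple R] f ->
            ('E_(P n)[fun w => (f (subvector (X n) s w) ^+ 2)%R] < +oo)%E ->
            (`|covariance (P n) (f \o subvector (X n) s) (X n t1)| <=
             (Num.sqrt (fine 'E_(P n)[fun w => (f (subvector (X n) s w) ^+ 2)%R])
                * theta r)%:E)%E)
         /\
         (forall f : u.+1.-tuple R -> R, measurable_fun [set: u.+1.-tuple R] f ->
            bounded_fun f ->
            (`|covariance (P n) (f \o subvector (X n) s)
                 (fun w => (X n t1 w * X n t2 w)%R)| <=
             (sup_norm f * theta r)%:E)%E)) :
  cvg_in_distribution P
    (fun n w => (Num.sqrt n%:R)^-1 * \sum_(1 <= k < n.+1) X n k w)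
    (centered_normal sigma).
Proof.
pose Z n w := (Num.sqrt n%:R)^-1 * \sum_(1 <= k < n.+1) X n k w.
have theta_ge0 := rate_ge0 theta_nonincreasing theta_summable.
have C_ge0 : 0 <= C.
  have := X_moment2 1%N 1%N isT; rewrite -lee_fin; apply: le_trans.
  by apply: expectation_ge0 => w; exact: sqr_ge0.
have mS n := measurable_psum (measurable_row (X n) n) n.
have S2int n := psum_sqr_int (measurable_row (X n) n) (row_sqr_int (X_moment2 n)) n.
have ZE n w : Z n w = (Num.sqrt n%:R)^-1 * psum (row (X n) n) n w.
  by rewrite psum_row.
have mZ n : measurable_fun [set: T n] (Z n).
  rewrite (_ : Z n = fun w => (Num.sqrt n%:R)^-1 * psum (row (X n) n) n w).
    exact: measurable_funM.
  by apply/funext => w; exact: ZE.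
have Z2E n w : Z n w ^+ 2 = n%:R^-1 * psum (row (X n) n) n w ^+ 2.
  by rewrite ZE exprMn exprVn sqr_sqrtr.
have Z2int n : rintegrable (P n) (fun w => Z n w ^+ 2).
  by under eq_fun do rewrite Z2E; exact: rintegrableZ.
have Z2mean n : mean (P n) (fun w => Z n w ^+ 2) =
    n%:R^-1 * mean (P n) (fun w => psum (row (X n) n) n w ^+ 2).
  by rewrite -meanZ//; apply: eq_mean => w; exact: Z2E.
(* The variables are centered, so the variance of the sum is its second moment. *)
have Z2_cvg : mean (P n) (fun w => Z n w ^+ 2) @[n --> \oo] --> sigma ^+ 2.
  suff : (mean (P n) (fun w => Z n w ^+ 2))%:E @[n --> \oo] --> (sigma ^+ 2)%:E.
    by move/fine_cvg.
  move: X_variance; apply: cvg_trans; apply: near_eq_cvg; near=> n => /=.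
  rewrite (_ : (fun w => _) = psum (row (X n) n) n); last first.
    by apply/funext => w; rewrite psum_row.
  have iS := rintegrable_sqr (mS n) (S2int n).
  rewrite /variance covariance_mean//.
  rewrite (_ : mean (P n) (psum _ _) = 0); last first.
    rewrite /psum mean_sum ?big1// => [k _|k].
      exact: (row_centered (X_centered n) (X_moment2 n) k).
    exact: (row_int (X_moment2 n)).
  by rewrite mulr0 subr0 -EFinM Z2mean mulrC.
(* The choice of eps and eta makes both halves of the bound at most e / 2. *)
have trunc_cvg (t : R) : \sum_(k < n.+1) mean (P n)
    (fun w => trunc_sqr (t * (Num.sqrt n%:R)^-1 * row (X n) n k w)) @[n --> \oo] --> 0.
  apply/cvgrPdist_le => e e0.
  have t3 : 0 < (1 + `|t|) ^+ 3 by rewrite exprn_gt0// ltr_wpDr.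
  pose eps := e / (2 * (1 + `|t|) ^+ 3 * (1 + C)).
  have C1 : 0 < 1 + C by lra.
  have eps0 : 0 < eps by rewrite divr_gt0// mulr_gt0// mulr_gt0.
  pose eta := e / (2 * (1 + `|t|) ^+ 3).
  have eta0 : 0 < eta by rewrite divr_gt0// mulr_gt0.
  have /fine_cvgP[_ /cvgrPdist_le/(_ _ eta0) lind] := X_lindeberg eps eps0.
  near=> n.
  have n_gt0 : (0 < n)%N by near: n; exists 1%N.
  have : `|0 - fine (n%:R^-1%:E * \sum_(1 <= k < n.+1) 'E_(P n)[fun w => (X n k w ^+ 2 *
      \1_[set w' | eps < `|X n k w'| / Num.sqrt n%:R] w)%R])%E| <= eta by near: n.
  rewrite (eq_big_nat _ _ (F2 := fun k => (mean (P n) (fun w => X n k w ^+ 2 *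
      \1_[set w' | eps < `|X n k w'| / Num.sqrt n%:R] w))%:E)); last first.
    by move=> k kn; rewrite mean_EFin//; exact: (large_int (X_moment2 n)).
  rewrite sumEFin -EFinM/= sub0r normrN => /(le_trans (ler_norm _)) lind_n.
  rewrite sub0r normrN ger0_norm; last first.
    by apply: sumr_ge0 => k _; apply: mean_ge0 => w; exact: trunc_sqr_ge0.
  apply: le_trans (row_trunc_sqr_le (X_moment2 n) C_ge0 t n_gt0 eps0) _.
  rewrite mulrC -ler_pdivlMr//.
  have -> : e / (1 + `|t|) ^+ 3 = eps * (1 + C) + eta.
    by rewrite /eps /eta; field; rewrite !lt0r_neq0// ltr_wpDr.
  by apply: lerD lind_n; rewrite ler_wpM2l ?(ltW eps0)//; lra.
have cos_cvg (t c : R) : mean (P n) (fun w => cos (t * Z n w + c)) @[n --> \oo] -->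
    mean (centered_normal sigma) (fun x : R => cos (t * x + c)).
  have -> : mean (centered_normal sigma) (fun x : R => cos (t * x + c)) =
      expR (- ((t * sigma) ^+ 2 / 2)) * cos c.
    rewrite /centered_normal; case: eqVneq => [->|s0]; last exact: mean_cos_normal_prob.
    rewrite /mean /Rintegral integral_dirac//=; last first.
      apply/measurable_EFinP; apply: continuous_measurable_fun => x.
      apply: (@continuous_comp _ _ _ (fun x : R => t * x + c) (@cos R)).
        by apply: cvgD; [apply: cvgM; [exact: cvg_cst|exact: cvg_id]|exact: cvg_cst].
      exact: continuous_cos.
    by rewrite indicT mul1r !mulr0 add0r expr0n mul0r oppr0 expR0 mul1r.
  pose V n := mean (P n) (fun w => Z n w ^+ 2).
  have G_cvg : expR (- (t ^+ 2 * V n / 2)) * cos c @[n --> \oo] -->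
      expR (- ((t * sigma) ^+ 2 / 2)) * cos c.
    apply: cvgM; last exact: cvg_cst.
    apply: (@continuous_cvg _ _ _ _ _ _ (@expR R)); first exact: continuous_expR.
    apply: (@cvgN _ R^o); rewrite exprMn; apply: cvgM; last exact: cvg_cst.
    by apply: cvgM; [exact: cvg_cst|exact: Z2_cvg].
  have [B hB] := rate_sum_le theta_nonincreasing theta_summable.
  have B0 : 0 <= B by have := hB 0%N; rewrite big_geq.
  pose A := (1 + t ^+ 2) * (1 + C).
  have A0 : 0 < A by have t2 := sqr_ge0 t; rewrite mulr_gt0//; lra.
  pose M := expR (A * (1 + 2 * B)).
  have M0 : 0 < M by exact: expR_gt0.
  apply/cvgrPdist_le => e e0.
  pose tau := e / (12 * M * A).
  have tau0 : 0 < tau by apply: divr_gt0 => //; apply: mulr_gt0 A0; exact: mulr_gt0.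
  (* The cut-off is fixed before n tends to infinity: in the limit the error
     bound is 3 * M * A * tau = e / 4. *)
  have [dd hdd] := rate_tail_small theta_nonincreasing theta_summable tau0.
  pose delta n : R := A / n%:R.
  have delta_cvg : delta n @[n --> \oo] --> 0.
    apply/cvgrPdist_le => a a0; near=> n.
    have n_gt0 : (0 < n)%N by near: n; exists 1%N.
    rewrite sub0r normrN ger0_norm; last by apply: divr_ge0 => //; exact: ltW.
    rewrite ler_pdivrMr ?ltr0n// mulrC -ler_pdivrMr//.
    by near: n; exact: nbhs_infty_ger.
  pose c1 : R := (8 * dd + 5)%:R * (3 * dd).+1%:R ^+ 4.
  pose r n := \sum_(k < n.+1) mean (P n)
    (fun w => trunc_sqr (t * (Num.sqrt n%:R)^-1 * row (X n) n k w)).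
  pose bound n := M * (c1 * r n + A * (4 * dd.+1%:R * ((3 * dd).+1%:R * Num.sqrt (delta n))
    + 3 * tau + delta n * (1 + 2 * B) ^+ 2)).
  have bound_cvg : bound n @[n --> \oo] --> M * (c1 * 0 +
      A * (4 * dd.+1%:R * ((3 * dd).+1%:R * Num.sqrt 0) + 3 * tau + 0 * (1 + 2 * B) ^+ 2)).
    apply: cvgM; first exact: cvg_cst.
    apply: cvgD; first by apply: cvgM; [exact: cvg_cst|exact: trunc_cvg].
    apply: cvgM; first exact: cvg_cst.
    apply: cvgD; last by apply: cvgM; [exact: delta_cvg|exact: cvg_cst].
    apply: cvgD; last exact: cvg_cst.
    apply: cvgM; first exact: cvg_cst.
    apply: cvgM; first exact: cvg_cst.
    by apply: (continuous_cvg _ (@sqrt_continuous R 0)).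
  rewrite sqrtr0 !mulr0 mul0r addr0 !add0r in bound_cvg.
  have lim_lt : M * (A * (3 * tau)) < e / 2.
    rewrite (_ : M * (A * (3 * tau)) = e / 4); first by lra.
    by rewrite /tau; field; rewrite !lt0r_neq0.
  have e20 : 0 < e / 2 by lra.
  near=> n.
  have n_gt0 : (0 < n)%N by near: n; exists 1%N.
  have nR : 0 < n%:R :> R by rewrite ltr0n.
  have bound_n : bound n <= e / 2.
    by apply: ltW; near: n; exact: (cvgr_lt _ bound_cvg).
  have delta_n : delta n * (1 + 2 * B) <= 1.
    rewrite -ler_pdivlMr ?div1r; last by lra.
    apply: ltW; near: n; apply: (cvgr_lt _ delta_cvg).
    by rewrite invr_gt0; lra.
  have delta0 : 0 < delta n by rewrite divr_gt0.
  have a2 : (t * (Num.sqrt n%:R)^-1) ^+ 2 = t ^+ 2 / n%:R.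
    by rewrite exprMn exprVn sqr_sqrtr.
  have aC : (t * (Num.sqrt n%:R)^-1) ^+ 2 * (1 + C) <= delta n.
    rewrite a2 /delta /A mulrAC ler_wpM2r ?invr_ge0//.
    by rewrite ler_wpM2r ?lerDr//; lra.
  have wd : (n0 <= n)%N by near: n; exists n0.
  have main := row_cos_mean_close C_ge0 (X_centered n) (X_moment2 n) theta_ge0
    (X_weak_dependence n wd) c delta0 aC theta_nonincreasing hB hdd delta_n.
  have nd : n%:R * delta n = A by rewrite /delta mulrC divfK// lt0r_neq0.
  rewrite nd -/M -/c1 -/(r n) -/(bound n) in main.
  have arg w : t * (Num.sqrt n%:R)^-1 * psum (row (X n) n) n w + c = t * Z n w + c.
    by rewrite ZE mulrA.
  rewrite (_ : (fun w => _) = (fun w => cos (t * Z n w + c))) in main; last first.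
    by apply/funext => w; rewrite arg.
  rewrite a2 -[t ^+ 2 / _ * _]mulrA -Z2mean -/(V n) in main.
  have G_n : `|expR (- ((t * sigma) ^+ 2 / 2)) * cos c -
      expR (- (t ^+ 2 * V n / 2)) * cos c| <= e / 2.
    by near: n; move/cvgrPdist_le : G_cvg => /(_ _ e20).
  apply: le_trans (ler_distD (expR (- (t ^+ 2 * V n / 2)) * cos c) _ _) _.
  rewrite [X in _ + X]distrC; have := le_trans main bound_n; lra.
(* A bounded set of reals is bounded by every number above some M. *)
move=> g cg [M [Mreal gM]].
have g_le x : `|g x| <= `|M| + 1.
  by apply: gM => //; rewrite (le_lt_trans (ler_norm M))// ltrDl.
have near_le : \forall n \near \oo, mean (P n) (fun w => Z n w ^+ 2) <= sigma ^+ 2 + 1.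
  have /cvgrPdist_le/(_ _ ltr01) := Z2_cvg.
  apply: filterS => n; rewrite ler_distlC => /andP[]; lra.
have := mean_cvg_of_cos mZ cos_cvg Z2int near_le cg g_le.
have mg : measurable_fun [set: R] g by exact: continuous_measurable_fun.
have Eg n : 'E_(P n)[g \o Z n]%E = (mean (P n) (fun w => g (Z n w)))%:E.
  rewrite -mean_EFin//; apply: (rintegrable_bounded _ (M := `|M| + 1)) => //.
  exact: (measurableT_comp mg).
have -> : (\int[centered_normal sigma]_x (g x)%:E)%E = (mean (centered_normal sigma) g)%:E.
  rewrite /mean /Rintegral fineK//; apply: integrable_fin_num => //.
  exact: (@rintegrable_bounded _ _ _ (centered_normal sigma) g (`|M| + 1) mg g_le).
move=> h; under eq_fun do rewrite Eg.
by apply: cvg_EFin; [exact: nearW|exact: h].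
Unshelve. all: by end_near.
Qed.
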